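(* Let $\alpha>0$, let $\mu$ be a positive Borel measure on $\mathbb{C}$, and let $p\ge 1$ and $r>0$. Then the following conditions are equivalent. (a) $\mu$ is a vanishing harmonic Fock-Carleson measure for $F^p_h$. (b) $\mu(B(z,r))\to 0$ as $|z|\to+\infty$. (c) $\widetilde{\mu}(z)\to 0$ as $|z|\to+\infty$.
   Context: Here $dA$ is area (Lebesgue) measure on $\mathbb{C}$ and $B(z,r)=\{\omega\in\mathbb{C}:|\omega-z|<r\}$. The harmonic Fock space $F^p_h$ is the space of all (complex-valued) harmonic functions $f$ on $\mathbb{C}$ with $\|f\|_{h,p}=\left\{\frac{p\alpha}{2\pi}\int_{\mathbb{C}}|f(z)e^{-\alpha|z|^2/2}|^p dA(z)\right\}^{1/p}<\infty$. A positive Borel measure $\mu$ is a harmonic Fock-Carleson measure for $F^p_h$ if there is a constant $C>0$ with $\int_{\mathbb{C}}|f(z)e^{-\alpha|z|^2/2}|^p d\mu(z)\le C\int_{\mathbb{C}}|f(z)e^{-\alpha|z|^2/2}|^p dA(z)$ for all $f\in F^p_h$. A harmonic Fock-Carleson measure $\mu$ for $F^p_h$ is called vanishing if $\lim_{n\to\infty}\int_{\mathbb{C}}|f_n(z)e^{-\alpha|z|^2/2}|^p d\mu(z)=0$ for every bounded sequence $\{f_n\}$ in $F^p_h$ that converges to $0$ uniformly on compact subsets of $\mathbb{C}$. For $z\in\mathbb{C}$ put $k_z(\omega)=e^{\alpha\bar z\omega-\frac{\alpha}{2}|z|^2}$ and $h_z(\omega)=\frac{\sqrt2}{2}\left(k_z(\omega)+\overline{k_z(\omega)}\right)$.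 The Berezin transform of $\mu$ is $\widetilde{\mu}(z)=\int_{\mathbb{C}}|h_z(u)|^2e^{-\alpha|u|^2}d\mu(u)$.
   Formalization: The positive Borel measure μ is additionally assumed to be finite on compact sets; without this the claim fails, e.g. μ = +∞ times the Dirac mass at 0 satisfies (b) but neither (a) nor (c). *)

(* Defs.v *)
From HB Require Import structures.
From mathcomp Require Import all_boot all_order all_algebra.
From mathcomp Require Import complex.
From mathcomp Require Import all_classical all_reals all_analysis.

Set Implicit Arguments.
Unset Strict Implicit.
Unset Printing Implicit Defensive.

Import Order.TTheory GRing.Theory Num.Theory.
Import numFieldNormedType.Exports.
Import Normc.

Local Open Scope classical_set_scope.
Local Open Scope ring_scope.

(* Algebra takes place in R[i].  Topology, differentiation and measure theory
   take place on R * R, identified with R[i] through [toC]; the Borel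
   sigma-algebra of the plane is the product of the Borel sigma-algebras of
   the two factors. *)
Notation plane R := (measurableTypeR R * measurableTypeR R)%type.

Definition toC (R : realType) (w : R * R) : R[i] := Complex w.1 w.2.

Definition area (R : realType) : {measure set (plane R) -> \bar R} :=
  (@lebesgue_measure R \x @lebesgue_measure R)%E.

Definition disk (R : realType) (z : R[i]) (r : R) : set (plane R) :=
  [set w | normc (toC w - z) < r].

(* The filter of neighbourhoods of infinity: the limit as |z| -> +oo. *)
Definition cinfty (R : realType) : set_system R[i] :=
  filter_from [set: R] (fun M => [set z | M < normc z]).
Arguments cinfty R : clear implicits.

Definition class_C1 (R : realType) (u : R * R -> R) : Prop :=
  [/\ forall w, derivable u w (1, 0) /\ derivable u w (0, 1),
      continuous ('D_(1, 0) u) & continuous ('D_(0, 1) u)].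

Definition class_C2 (R : realType) (u : R * R -> R) : Prop :=
  [/\ class_C1 u, class_C1 ('D_(1, 0) u) & class_C1 ('D_(0, 1) u)].

Definition laplacian (R : realType) (u : R * R -> R) : R * R -> R :=
  fun w => 'D_(1, 0) ('D_(1, 0) u) w + 'D_(0, 1) ('D_(0, 1) u) w.

Definition real_harmonic (R : realType) (u : R * R -> R) : Prop :=
  class_C2 u /\ forall w, laplacian u w = 0.

Definition complex_harmonic (R : realType) (f : R[i] -> R[i]) : Prop :=
  real_harmonic (fun w => complex.Re (f (toC w))) /\
  real_harmonic (fun w => complex.Im (f (toC w))).

Section Fock.
Variables (R : realType) (alpha p : R).

Definition weighted_integral (m : {measure set (plane R) -> \bar R})
    (f : R[i] -> R[i]) : \bar R :=
  (\int[m]_w ((normc (f (toC w)) *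
               expR (- (alpha * normc (toC w) ^+ 2 / 2))) `^ p)%:E)%E.

Definition fock_norm (f : R[i] -> R[i]) : \bar R :=
  poweR ((p * alpha / (2 * pi))%:E * weighted_integral (area R) f)%E p^-1.

Definition harmonic_fock : set (R[i] -> R[i]) :=
  [set f | complex_harmonic f /\ (fock_norm f < +oo)%E].

Definition fock_carleson (mu : {measure set (plane R) -> \bar R}) : Prop :=
  exists2 C : R, 0 < C & forall f, harmonic_fock f ->
    (weighted_integral mu f <= C%:E * weighted_integral (area R) f)%E.

Definition fock_bounded (f : nat -> R[i] -> R[i]) : Prop :=
  exists M : R, forall n, (fock_norm (f n) <= M%:E)%E.

Definition cvg0_on_compacts (f : nat -> R[i] -> R[i]) : Prop :=
  forall K : set (R * R), compact K -> forall e : R, 0 < e ->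
    \forall n \near \oo, forall w, K w -> normc (f n (toC w)) < e.

Definition vanishing_fock_carleson
    (mu : {measure set (plane R) -> \bar R}) : Prop :=
  fock_carleson mu /\
  forall f : nat -> R[i] -> R[i], (forall n, harmonic_fock (f n)) ->
    fock_bounded f -> cvg0_on_compacts f ->
    weighted_integral mu (f n) @[n --> \oo] --> 0%E.

End Fock.

Definition cexp (R : realType) (z : R[i]) : R[i] :=
  Complex (expR (complex.Re z) * cos (complex.Im z))
          (expR (complex.Re z) * sin (complex.Im z)).

Definition kfun (R : realType) (alpha : R) (z w : R[i]) : R[i] :=
  cexp (real_complex R alpha * conjc z * w
        - real_complex R (alpha / 2 * normc z ^+ 2)).

Definition hfun (R : realType) (alpha : R) (z w : R[i]) : R[i] :=
  real_complex R (Num.sqrt 2 / 2) * (kfun alpha z w + conjc (kfun alpha z w)).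

Definition berezin (R : realType) (alpha : R)
    (mu : {measure set (plane R) -> \bar R}) (z : R[i]) : \bar R :=
  (\int[mu]_u (normc (hfun alpha z (toC u)) ^+ 2 *
               expR (- (alpha * normc (toC u) ^+ 2)))%:E)%E.

(* Finiteness on compact sets is part of the usual convention for Borel
   measures here: without it, the measure equal to +oo times the Dirac mass
   at 0 has mu(B(z,r)) -> 0 but is not a Fock-Carleson measure. *)
Definition finite_on_compacts (R : realType)
    (mu : {measure set (plane R) -> \bar R}) : Prop :=
  forall K : set (R * R), compact K -> (mu K < +oo)%E.

(* Main.v *)
Require Import Defs.
From HB Require Import structures.
From mathcomp Require Import all_boot all_order all_algebra.
From mathcomp Require Import complex ring lra measurable_realfun.
From mathcomp Require Import all_classical all_reals all_analysis.

Import Order.TTheory GRing.Theory Num.Theory.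
Import numFieldNormedType.Exports.
Import Normc.

Local Open Scope classical_set_scope.
Local Open Scope ring_scope.

(** All three conditions are compared with the behaviour at infinity of
    [mu (B(x, r))], a quantity that is written [mu (ball2 x r)] below.

    From (a) to (b) the test functions are the kernels [k_z]: they are
    holomorphic, their weighted moduli are Gaussians centred at [z], so they form
    a bounded family, and they tend to [0] uniformly on compact sets as [z] goes
    to infinity ([small_of_vanishing]).

    From (b) to (c), [|h_z|^2] is at most twice a Gaussian, and the Gaussian
    potentials [int gauss c w z dmu(z)] tend to [0] when [mu (ball2 x r)] does:
    a Gaussian is dominated by its averages over discs of radius [r], so by
    Tonelli the potential is dominated by a Gaussian average of
    [x |-> mu (ball2 x r)] ([potential_vanishes]).

    From (c) back to (b), the obstacle is that [h_z] vanishes along lines.  A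
    displacement of [z] by a length of order [1 / |z|] turns cosines into sines,
    so that the transforms at two close points control [mu (ball2 z r)]
    ([small_of_berezin]).

    From (b) to (a), one needs a pointwise bound of
    [F(z) = |f(z)| exp (- alpha |z|^2 / 2)] by integrals of [F].  The estimate
    [F(z)^p <= C int_{B(z,1)} F^p] has a short proof for holomorphic [f], because
    [f] may be multiplied by [exp (- alpha conj z w)], but this destroys
    harmonicity.  The gradient of a harmonic [u] however is essentially the
    holomorphic function [u_x - i u_y], so the local estimate holds for the
    gradient, with a loss of a factor [1 + |z|] ([gradient_bound]).
    Integrating along the segment from [0] to [z], on which [exp (alpha |w|^2 / 2)]
    decays like [exp (- alpha |z| s)] in the distance [s] from [z], regains
    exactly this factor, and gives [F(z)^p <= C int F(w)^p exp (- alpha |w - z|^2 / 8) dA(w)]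
    ([growth_bound], [complex_growth]).  By Tonelli, [int F^p dmu] is then at most
    [C int F^p P dA] with [P] a Gaussian potential of [mu]; boundedness of [P]
    gives the Carleson property, and its decay at infinity makes the measure
    vanishing ([vanishing_of_potential]).

    Everything up to this last step takes place on [R * R], for real-valued
    functions; the mean value property of holomorphic functions is obtained from
    the divergence theorem on squares, by differentiating an average along
    dilations ([cauchy_riemann_mean_value]). *)

(** * Continuously differentiable functions on the plane *)

Section C1.
Context {R : realType}.
Implicit Types (u v ux uy vx vy : R * R -> R).

(** The partial derivatives are explicit and are derivatives of slices, which
    reduces closure under algebraic operations to one-variable calculus. *)
Definition has_C1 u ux uy :=
  [/\ forall x y, is_derive x (1 : R) (fun s => u (s, y)) (ux (x, y)),
      forall x y, is_derive y (1 : R) (fun t => u (x, t)) (uy (x, y)),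
      continuous ux & continuous uy].

Lemma partial1E u x y : (fun h : R => h^-1 *: ((u \o shift (x, y)) (h *: ((1, 0) : R * R)) - u (x, y)))
  = (fun h : R => h^-1 *: (((fun s => u (s, y)) \o shift x) (h *: (1 : R)) - u (x, y))).
Proof.
apply/funext => h /=; congr (_ *: (u _ - _)).
by apply/eqP; rewrite xpair_eqE /= !scaler0 add0r !eqxx.
Qed.

Lemma partial2E u x y : (fun h : R => h^-1 *: ((u \o shift (x, y)) (h *: ((0, 1) : R * R)) - u (x, y)))
  = (fun h : R => h^-1 *: (((fun t => u (x, t)) \o shift y) (h *: (1 : R)) - u (x, y))).
Proof.
apply/funext => h /=; congr (_ *: (u _ - _)).
by apply/eqP; rewrite xpair_eqE /= !scaler0 add0r !eqxx.
Qed.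

Lemma class_C1_has_C1 u : class_C1 u -> has_C1 u ('D_(1, 0) u) ('D_(0, 1) u).
Proof.
case=> du cx cy; split; [move=> x y|move=> x y|exact: cx|exact: cy]; have [d1 d2] := du (x, y).
- apply: DeriveDef; first by move: d1; rewrite /derivable partial1E.
  by rewrite /derive partial1E.
- apply: DeriveDef; first by move: d2; rewrite /derivable partial2E.
  by rewrite /derive partial2E.
Qed.

Lemma has_C1_D {u ux uy} : has_C1 u ux uy ->
  'D_(1, 0) u = ux /\ 'D_(0, 1) u = uy.
Proof.
move=> [dx dy _ _]; split; apply/funext => -[x y].
- by rewrite /derive partial1E; case: (dx x y).
- by rewrite /derive partial2E; case: (dy x y).
Qed.

Lemma has_C1_class_C1 {u ux uy} : has_C1 u ux uy -> class_C1 u.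
Proof.
move=> hu; have [ex ey] := has_C1_D hu; case: hu => dx dy cx cy.
split; rewrite ?ex ?ey // => -[x y]; split.
- by rewrite /derivable partial1E; case: (dx x y).
- by rewrite /derivable partial2E; case: (dy x y).
Qed.

Lemma MVT_everywhere (f df : R -> R) :
  (forall x, is_derive x (1 : R) f (df x)) ->
  forall a b, exists2 c, `|c - a| <= `|b - a| & f b - f a = df c * (b - a).
Proof.
move=> fdf a b.
have cf : continuous f.
  by move=> x; apply/differentiable_continuous/derivable1_diffP; case: (fdf x).
have [ab|ba|->] := ltgtP a b; last by exists b; rewrite ?subrr ?mulr0.
- have [c cab ->] := MVT ab (fun x _ => fdf x) (continuous_subspaceT cf).
  exists c => //; move: cab; rewrite in_itv /= => /andP[ac cb].
  by rewrite !ger0_norm ?subr_ge0 ?(ltW ab) ?(ltW ac) // lerD2r ltW.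
- have [c cab e] := MVT ba (fun x _ => fdf x) (continuous_subspaceT cf).
  exists c; last by rewrite -opprB e -mulrN opprB.
  move: cab; rewrite in_itv /= => /andP[ac cb].
  by rewrite !ler0_norm ?subr_le0 ?(ltW ba) ?(ltW cb) // !opprB lerD2l lerN2 ltW.
Qed.

Let V : normedModType R := (R * R)%type.

(** Two mean value steps, one along each axis, show that continuity of the
    partial derivatives yields total differentiability. *)
Lemma has_C1_littleo {u ux uy} (w : V) : has_C1 u ux uy ->
  (u : V -> R) \o shift w = cst (u w) + (fun h : V => h.1 * ux w + h.2 * uy w) +o_ 0 id.
Proof.
case: w => x y [dx dy cx cy]; apply/eqaddoP => _/posnumP[e].
have e2 : 0 < e%:num / 2 by [].
have /cvgrPdist_lt /(_ _ e2) /nbhs_ballP[d1 d10 h1] := cx (x, y).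
have /cvgrPdist_lt /(_ _ e2) /nbhs_ballP[d2 d20 h2] := cy (x, y).
near=> h.
have hd1 : `|h| < d1 by near: h; apply: (@nbhs0_lt _ V).
have hd2 : `|h| < d2 by near: h; apply: (@nbhs0_lt _ V).
have [h1m h2m] : `|h.1| <= `|h| /\ `|h.2| <= `|h|.
  by rewrite !num_le_max !lexx orbT.
have [c1 c1P e1] := MVT_everywhere _ _ (dx ^~ (y + h.2)) x (x + h.1).
have [c2 c2P e2'] := MVT_everywhere _ _ (dy x) y (y + h.2).
rewrite /= in e1 e2'.
rewrite addrAC subrr add0r in c1P; rewrite addrAC subrr add0r in c2P.
have -> : ((u \o shift (x, y)) - (cst (u (x, y)) + (fun h => h.1 * ux (x, y) + h.2 * uy (x, y)))) h
  = (ux (c1, y + h.2) - ux (x, y)) * h.1 + (uy (x, c2) - uy (x, y)) * h.2.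
  transitivity (u (h.1 + x, h.2 + y) - (u (x, y) + (h.1 * ux (x, y) + h.2 * uy (x, y)))) => //.
  rewrite (addrC h.1 x) (addrC h.2 y); move: e1 e2'; set A := u _; set B := u _; set C := u _.
  move=> e1 e2'; have -> : A = B + ux (c1, y + h.2) * (x + h.1 - x) by rewrite -e1; ring.
  have -> : B = C + uy (x, c2) * (y + h.2 - y) by rewrite -e2'; ring.
  by ring.
have b1 : `|ux (c1, y + h.2) - ux (x, y)| <= e%:num / 2.
  rewrite distrC ltW //; apply: h1; split => /=; rewrite -ball_normE /= distrC.
    exact: le_lt_trans c1P (le_lt_trans h1m hd1).
  by rewrite addrAC subrr add0r (le_lt_trans h2m).
have b2 : `|uy (x, c2) - uy (x, y)| <= e%:num / 2.
  rewrite distrC ltW //; apply: h2; split => /=; rewrite -ball_normE /= distrC.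
    by rewrite subrr normr0.
  exact: le_lt_trans c2P (le_lt_trans h2m hd2).
rewrite (le_trans (ler_normD _ _)) // !normrM.
rewrite [leRHS](_ : _ = e%:num / 2 * `|h| + e%:num / 2 * `|h|); last by rewrite /=; field.
by apply: lerD; apply: ler_pM.
Unshelve. all: by end_near. Qed.

Lemma has_C1_differentiable {u ux uy} w : has_C1 u ux uy ->
  is_diff w u (fun h => h.1 * ux w + h.2 * uy w).
Proof.
move=> hu; pose d h := h.1 * ux w + h.2 * uy w.
have lin_d : linear d.
  by move=> k [a b] [a' b']; rewrite /d /= /GRing.scale /=; ring.
pose dM := GRing.isLinear.Build _ _ _ _ _ lin_d.
pose dL : {linear _ -> _} := HB.pack d dM.
have cd : continuous d.
  move=> h; apply: cvgD; apply: cvgM; try exact: cvg_cst.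
    exact: cvg_fst.
  exact: cvg_snd.
have o := has_C1_littleo w hu.
have e : 'd u w = d :> (_ -> _) by rewrite -/d -[d]/(dL : _ -> _); apply: diff_unique.
apply: DiffDef => //; apply/diff_locallyP; rewrite e; split => //.
Qed.

Lemma has_C1_continuous {u ux uy} : has_C1 u ux uy -> continuous u.
Proof.
by move=> hu w; apply: differentiable_continuous; case: (has_C1_differentiable w hu).
Qed.

(** Differentiability from a quadratic remainder: besides affine functions and
    the square this covers the corner of the squared positive part. *)
Lemma is_derive_quadratic (f : R -> R) (s d : R) :
  (forall h, `|f (h + s) - f s - h * d| <= h ^+ 2) -> is_derive s (1 : R) f d.
Proof.
move=> fs.
have cf : (fun h : R => h^-1 *: ((f \o shift s) (h *: (1 : R)) - f s)) @ 0^' --> d.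
  apply/cvgrPdist_lt => e e0; near=> h.
  have h0 : h != 0 by near: h; exact: nbhs_dnbhs_neq.
  rewrite /= [h *: 1]mulr1 /GRing.scale /=.
  have -> : d - h^-1 * (f (h + s) - f s) = - h^-1 * (f (h + s) - f s - h * d).
    by field.
  rewrite normrM normrN normfV ltr_pdivrMl ?normr_gt0 //.
  apply: le_lt_trans (fs h) _; rewrite -real_normK ?num_real // expr2.
  rewrite ltr_pM2l ?normr_gt0 //; near: h; exact: dnbhs0_lt.
by apply: DeriveDef; [apply/cvg_ex; exists d|apply: cvg_lim].
Unshelve. all: by end_near. Qed.

Lemma has_C1_line {u ux uy} (w a : R * R) (t : R) : has_C1 u ux uy ->
  is_derive t (1 : R) (fun s => u (w.1 + s * a.1, w.2 + s * a.2))
   (a.1 * ux (w.1 + t * a.1, w.2 + t * a.2) + a.2 * uy (w.1 + t * a.1, w.2 + t * a.2)).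
Proof.
move=> hu.
have l1 (x b : R) : is_diff t (fun s : R => x + s * b) ( *%R^~ b).
  have d : is_derive t (1 : R) (fun s : R => x + s * b) b.
    apply: is_derive_quadratic => h.
    by rewrite [X in `|X|](_ : _ = 0) ?normr0 ?sqr_ge0 //; ring.
  case: d => d1 d2; apply: DiffDef; first exact/derivable1_diffP.
  by rewrite deriv1E // derive1E d2.
have := has_C1_differentiable (w.1 + t * a.1, w.2 + t * a.2) hu.
move=> du.
have dc := is_diff_comp (is_diff_pair (l1 w.1 a.1) (l1 w.2 a.2)) du.
apply: DeriveDef; first by apply: diff_derivable; case: dc.
rewrite deriveE; last by case: dc.
rewrite (@diff_val _ _ _ _ _ _ _ dc) /= !mul1r //.
Qed.

End C1.

(** * Borel sets of the plane and integration over squares *)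

Lemma continuous_pair (T U V : topologicalType) (f : T -> U) (g : T -> V) :
  continuous f -> continuous g -> continuous (fun x => (f x, g x)).
Proof.
move=> cf cg x.
exact: (@cvg_pair _ _ _ (nbhs x) (nbhs (f x)) (nbhs (g x)) _ _ _ _ _ (cf x) (cg x)).
Qed.

Section plane_measure.
Context {R : realType}.
Local Notation area := (area R).
Local Notation leb := (@lebesgue_measure R).

(** The topology is that of [R * R] while the sigma-algebra is a product; an
    open set is the countable union of the rational squares that it contains. *)
Lemma open_measurable_plane (U : set (R * R)) :
  open U -> measurable (U : set (plane R)).
Proof.
move=> oU; pose box (q : rat * rat * rat) : set (plane R) :=
  ball (ratr q.1.1 : R) (ratr q.2) `*` ball (ratr q.1.2 : R) (ratr q.2).
pose F q : set (plane R) := [set w | box q w /\ box q `<=` U].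
have -> : U = \bigcup_q F q.
  apply/seteqP; split => [[x y] Uxy|w [q _ [qw]]]; last by apply.
  have /nbhs_ballP[_/posnumP[e] eU] : nbhs (x, y) U by exact: open_nbhs_nbhs.
  have [q] : exists q, ratr q \in `]0, (e%:num / 2)[ by apply: rat_in_itvoo.
  rewrite in_itv /= => /andP[q0 qe].
  have [a [/= xa [a' _ aE]]] : ball x (ratr q) `&` range ratr !=set0.
    by apply: dense_rat; [exists x; exact: ballxx|exact: ball_open].
  have [b [/= yb [b' _ bE]]] : ball y (ratr q) `&` range ratr !=set0.
    by apply: dense_rat; [exists y; exact: ballxx|exact: ball_open].
  subst a b; exists (a', b', q) => //; split.
    by split; apply: ball_sym.
  have qqe : ratr q + ratr q <= e%:num by rewrite (splitr e%:num) lerD // ltW.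
  move=> [s t] [/= sa tb]; apply: eU; split => /=.
    exact: le_ball qqe _ (ball_triangle xa sa).
  exact: le_ball qqe _ (ball_triangle yb tb).
apply: countable_bigcupT_measurable; first exact: countableP.
move=> q; have [sub|nsub] := pselect (box q `<=` U).
  have -> : F q = box q by apply/seteqP; split => [w []//|w]; split.
  by apply: measurableX; exact: measurable_ball.
have -> : F q = set0 by apply/seteqP; split => [w []//|w []].
exact: measurable0.
Qed.

Lemma continuous_measurable_plane (f : R * R -> R) :
  continuous f -> measurable_fun setT (f : plane R -> R).
Proof.
move=> /continuousP cf; apply: (measurability _ (RGenOpens.measurableE R)).
move=> _ [_ [a [b ->] <-]]; rewrite setTI.
by apply: open_measurable_plane; apply: cf; exact: interval_open.
Qed.

Definition box (z : R * R) (h : R) : set (plane R) :=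
  `[z.1 - h, z.1 + h]%classic `*` `[z.2 - h, z.2 + h]%classic.

Definition square (z : R * R) := box z 1.

Lemma measurable_box z h : measurable (box z h).
Proof. exact: measurableX. Qed.

Lemma measurable_square z : measurable (square z).
Proof. exact: measurable_box. Qed.

Lemma compact_box z h : compact (box z h : set (R * R)).
Proof. by apply: compact_setX; exact: segment_compact. Qed.

Lemma area_box (z : R * R) (h : R) : 0 <= h -> area (box z h) = (4 * h ^+ 2)%:E.
Proof.
move=> h0; have seg (a : R) : leb `[a - h, a + h]%classic = (2 * h)%:E.
  rewrite lebesgue_measure_itv /= lte_fin ltrD2l; case: ltP => hh.
    by rewrite -EFinB; congr (_%:E); ring.
  have -> : h = 0 by apply/le_anti; rewrite h0 andbT; lra.
  by rewrite mulr0.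
transitivity (leb `[(z.1 - h)%R, (z.1 + h)%R]%classic * leb `[(z.2 - h)%R, (z.2 + h)%R]%classic)%E.
  by rewrite [LHS](product_measure1E leb leb) //; exact: measurable_itv.
by rewrite !seg -EFinM; congr (_%:E); ring.
Qed.

Lemma continuous_integrable_square (f : R * R -> R) z :
  continuous f -> area.-integrable (square z) (EFin \o f).
Proof.
move=> cf; apply: measurable_bounded_integrable.
- exact: measurable_square.
- by rewrite [X in (X < _)%E](area_box z 1) ?ler01 // ltry.
- by apply: measurable_funTS; apply: continuous_measurable_plane.
- have cf' : {within square z, continuous f} by exact: continuous_subspaceT.
  have /compact_bounded[M [_ mrt]] := continuous_compact cf' (compact_box z 1).
  by exists M; split; rewrite ?num_real // => ? ? ? ?; exact: mrt.
Qed.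

Lemma integral_square12 (f : R * R -> R) z : continuous f ->
  (\int[area]_(w in square z) (f w)%:E =
   \int[leb]_(x in `[(z.1 - 1)%R, (z.1 + 1)%R]) \int[leb]_(y in `[(z.2 - 1)%R, (z.2 + 1)%R]) (f (x, y))%:E)%E.
Proof.
move=> cf; rewrite integral_mkcond -integral12_prod_meas1; last first.
  by apply/(integrable_mkcond _ (measurable_square z))/continuous_integrable_square.
rewrite [RHS]integral_mkcond; apply: eq_integral => x _; rewrite /fubini_F.
rewrite patchE; case: ifPn => xz.
  rewrite [RHS]integral_mkcond; apply: eq_integral => y _.
  by rewrite !patchE in_setX xz.
by apply: integral0_eq => y _; rewrite patchE in_setX (negbTE xz).
Qed.

Lemma integral_square21 (f : R * R -> R) z : continuous f ->
  (\int[area]_(w in square z) (f w)%:E =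
   \int[leb]_(y in `[(z.2 - 1)%R, (z.2 + 1)%R]) \int[leb]_(x in `[(z.1 - 1)%R, (z.1 + 1)%R]) (f (x, y))%:E)%E.
Proof.
move=> cf; rewrite integral_mkcond -integral21_prod_meas1; last first.
  by apply/(integrable_mkcond _ (measurable_square z))/continuous_integrable_square.
rewrite [RHS]integral_mkcond; apply: eq_integral => y _; rewrite /fubini_G.
rewrite patchE; case: ifPn => yz.
  rewrite [RHS]integral_mkcond; apply: eq_integral => x _.
  by rewrite !patchE in_setX yz andbT.
by apply: integral0_eq => x _; rewrite patchE in_setX (negbTE yz) andbF.
Qed.

Lemma integral_derivative_itv (g dg : R -> R) a : continuous dg ->
  (forall x, is_derive x (1 : R) g (dg x)) ->
  (\int[leb]_(x in `[(a - 1)%R, (a + 1)%R]) (dg x)%:E = (g (a + 1) - g (a - 1))%:E)%E.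
Proof.
move=> cdg gdg.
have cg : continuous g.
  by move=> x; apply/differentiable_continuous/derivable1_diffP; case: (gdg x).
rewrite (@continuous_FTC2 _ dg g) //.
- by rewrite ltrD2l; lra.
- exact: continuous_subspaceT.
- split; first by move=> x _; case: (gdg x).
    exact/cvg_at_right_filter/cg.
  exact/cvg_at_left_filter/cg.
- by move=> x _; rewrite derive1E; case: (gdg x).
Qed.

Lemma integral_partial1_eq0 u ux uy z : has_C1 u ux uy ->
  (forall y, u (z.1 - 1, y) = 0 /\ u (z.1 + 1, y) = 0) ->
  (\int[area]_(w in square z) ux w = 0).
Proof.
move=> [dx dy cx cy] u0; rewrite /Rintegral integral_square21 //.
rewrite integral0_eq // => y _.
rewrite (@integral_derivative_itv (fun x => u (x, y))) //; last first.
  by move=> x; apply: (@continuous_comp _ _ _ (fun x : R => (x, y)) ux); [apply: continuous_pair => t; [exact: cvg_id|exact: cvg_cst]|exact: cx].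
by have [-> ->] := u0 y; rewrite subrr.
Qed.

Lemma integral_partial2_eq0 u ux uy z : has_C1 u ux uy ->
  (forall x, u (x, z.2 - 1) = 0 /\ u (x, z.2 + 1) = 0) ->
  (\int[area]_(w in square z) uy w = 0).
Proof.
move=> [dx dy cx cy] u0; rewrite /Rintegral integral_square12 //.
rewrite integral0_eq // => x _.
rewrite (@integral_derivative_itv (fun y => u (x, y))) //; last first.
  by move=> y; apply: (@continuous_comp _ _ _ (fun y : R => (x, y)) uy); [apply: continuous_pair => t; [exact: cvg_cst|exact: cvg_id]|exact: cy].
by have [-> ->] := u0 x; rewrite subrr.
Qed.

(** Divergence theorem without boundary terms: integrate each partial derivative
    first in its own variable. *)
Lemma integral_divergence_eq0 p px py q qx qy z : has_C1 p px py -> has_C1 q qx qy ->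
  (forall y, p (z.1 - 1, y) = 0 /\ p (z.1 + 1, y) = 0) ->
  (forall x, q (x, z.2 - 1) = 0 /\ q (x, z.2 + 1) = 0) ->
  \int[area]_(w in square z) (px w + qy w) = 0.
Proof.
move=> hp hq p0 q0; rewrite RintegralD.
- by rewrite (integral_partial1_eq0 _ _ _ z hp p0) (integral_partial2_eq0 _ _ _ z hq q0) addr0.
- exact: measurable_square.
- by apply: continuous_integrable_square; case: hp.
- by apply: continuous_integrable_square; case: hq.
Qed.

End plane_measure.

(** * Calculus rules and a radial cutoff *)

Section C1_calculus.
Context {R : realType}.
Implicit Types (u v ux uy vx vy : R * R -> R).

Lemma has_C1_cst (c : R) : has_C1 (fun=> c) (fun=> 0) (fun=> 0).
Proof.
by split => [x y|x y|w|w]; try exact: cvg_cst; exact: is_derive_cst.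
Qed.

Lemma has_C1_fst : has_C1 (fun w : R * R => w.1) (fun=> 1) (fun=> 0).
Proof.
by split => [x y|x y|w|w]; try exact: cvg_cst; [exact: is_derive_id|exact: is_derive_cst].
Qed.

Lemma has_C1_snd : has_C1 (fun w : R * R => w.2) (fun=> 0) (fun=> 1).
Proof.
by split => [x y|x y|w|w]; try exact: cvg_cst; [exact: is_derive_cst|exact: is_derive_id].
Qed.

Lemma has_C1D {u ux uy v vx vy} : has_C1 u ux uy -> has_C1 v vx vy ->
  has_C1 (fun w => u w + v w) (fun w => ux w + vx w) (fun w => uy w + vy w).
Proof.
move=> [u1 u2 cux cuy] [v1 v2 cvx cvy]; split => [x y|x y|w|w].
- exact: is_deriveD.
- exact: is_deriveD.
- by apply: cvgD; [exact: cux|exact: cvx].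
- by apply: cvgD; [exact: cuy|exact: cvy].
Qed.

Lemma has_C1M {u ux uy v vx vy} : has_C1 u ux uy -> has_C1 v vx vy ->
  has_C1 (fun w => u w * v w) (fun w => ux w * v w + u w * vx w)
         (fun w => uy w * v w + u w * vy w).
Proof.
move=> hu hv; have cu := has_C1_continuous hu.
have cv := has_C1_continuous hv.
case: hu hv => [u1 u2 cux cuy] [v1 v2 cvx cvy]; split => [x y|x y|w|w].
- have h := is_deriveM (u1 x y) (v1 x y).
  apply: (@is_derive_eq _ _ _ _ _ _ _ _ h).
  by rewrite /GRing.scale /= addrC; congr (_ + _); rewrite mulrC.
- have h := is_deriveM (u2 x y) (v2 x y).
  apply: (@is_derive_eq _ _ _ _ _ _ _ _ h).
  by rewrite /GRing.scale /= addrC; congr (_ + _); rewrite mulrC.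
- by apply: cvgD; apply: cvgM; [exact: cux|exact: cv|exact: cu|exact: cvx].
- by apply: cvgD; apply: cvgM; [exact: cuy|exact: cv|exact: cu|exact: cvy].
Qed.

Lemma has_C1_comp {g dg : R -> R} {u ux uy} :
  (forall t, is_derive t (1 : R) g (dg t)) -> continuous dg -> has_C1 u ux uy ->
  has_C1 (fun w => g (u w)) (fun w => dg (u w) * ux w) (fun w => dg (u w) * uy w).
Proof.
move=> gdg cdg hu; have cu := has_C1_continuous hu.
case: hu => [u1 u2 cux cuy]; split => [x y|x y|w|w].
- have h := (@is_derive1_comp _ g (fun s => u (s, y)) _ _ _ (gdg _) (u1 x y)).
  apply: (@is_derive_eq _ _ _ _ _ _ _ _ h).
  by rewrite /GRing.scale.
- have h := (@is_derive1_comp _ g (fun s => u (x, s)) _ _ _ (gdg _) (u2 x y)).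
  apply: (@is_derive_eq _ _ _ _ _ _ _ _ h).
  by rewrite /GRing.scale.
- apply: cvgM; last exact: cux.
  by apply: (@continuous_comp _ _ _ u dg); [exact: cu|exact: cdg].
- apply: cvgM; last exact: cuy.
  by apply: (@continuous_comp _ _ _ u dg); [exact: cu|exact: cdg].
Qed.

Lemma has_C1_ext {u ux uy v vx vy} : has_C1 u ux uy ->
  u =1 v -> ux =1 vx -> uy =1 vy -> has_C1 v vx vy.
Proof. by move=> + /funext <- /funext <- /funext <-. Qed.

Lemma has_C1N {u ux uy} : has_C1 u ux uy ->
  has_C1 (fun w => - u w) (fun w => - ux w) (fun w => - uy w).
Proof.
move=> /(has_C1M (has_C1_cst (-1))) h.
by apply: (has_C1_ext h) => w; ring.
Qed.

Lemma has_C1B {u ux uy v vx vy} : has_C1 u ux uy -> has_C1 v vx vy ->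
  has_C1 (fun w => u w - v w) (fun w => ux w - vx w) (fun w => uy w - vy w).
Proof. by move=> hu /has_C1N hv; exact: has_C1D. Qed.

Lemma has_C1_affine (a b c : R) :
  has_C1 (fun w : R * R => a * w.1 + b * w.2 + c) (fun=> a) (fun=> b).
Proof.
have h := has_C1D (has_C1D
  (has_C1M (has_C1_cst a) has_C1_fst)
  (has_C1M (has_C1_cst b) has_C1_snd)) (has_C1_cst c).
by apply: (has_C1_ext h) => w; ring.
Qed.

Definition dilate (z : R * R) (l : R) (w : R * R) : R * R :=
  (z.1 + l * (w.1 - z.1), z.2 + l * (w.2 - z.2)).

Lemma continuous_dilate z l : continuous (dilate z l).
Proof.
apply: continuous_pair => w.
  apply: cvgD; first exact: cvg_cst.
  apply: cvgM; first exact: cvg_cst.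
  by apply: cvgB; [exact: cvg_fst|exact: cvg_cst].
apply: cvgD; first exact: cvg_cst.
apply: cvgM; first exact: cvg_cst.
by apply: cvgB; [exact: cvg_snd|exact: cvg_cst].
Qed.

Lemma has_C1_dilate {u ux uy} z l : has_C1 u ux uy ->
  has_C1 (fun w => u (dilate z l w)) (fun w => l * ux (dilate z l w))
         (fun w => l * uy (dilate z l w)).
Proof.
move=> [u1 u2 cux cuy].
have al (a x : R) : is_derive x (1 : R) (fun s => a + l * (s - a)) l.
  apply: is_derive_quadratic => h.
  by rewrite [X in `|X|](_ : _ = 0) ?normr0 ?sqr_ge0 //; ring.
split => [x y|x y|w|w].
- have h := (@is_derive1_comp _ (fun s => u (s, z.2 + l * (y - z.2))) _ _ _ _ (u1 _ _) (al z.1 x)).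
  apply: (@is_derive_eq _ _ _ _ _ _ _ _ h).
  by rewrite /GRing.scale /= mulrC.
- have h := (@is_derive1_comp _ (fun s => u (z.1 + l * (x - z.1), s)) _ _ _ _ (u2 _ _) (al z.2 y)).
  apply: (@is_derive_eq _ _ _ _ _ _ _ _ h).
  by rewrite /GRing.scale /= mulrC.
- apply: cvgM; first exact: cvg_cst.
  by apply: (@continuous_comp _ _ _ (dilate z l) ux); [exact: continuous_dilate|exact: cux].
- apply: cvgM; first exact: cvg_cst.
  by apply: (@continuous_comp _ _ _ (dilate z l) uy); [exact: continuous_dilate|exact: cuy].
Qed.

Lemma is_derive_sqr_pospart (s : R) :
  is_derive s (1 : R) (fun t => Num.max 0 t ^+ 2) (2 * Num.max 0 s).
Proof.
apply: is_derive_quadratic => h; rewrite ler_norml.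
have [hs|hs] := leP 0 (h + s); have [s0|s0] := leP 0 s.
- by apply/andP; split; nra.
- by apply/andP; split; nra.
- by apply/andP; split; nra.
- by apply/andP; split; nra.
Qed.

(** Radial, so that rotations preserve it, continuously differentiable, and zero
    on the boundary of the square centred at [z]. *)
Definition cutoff (z w : R * R) : R :=
  Num.max 0 (1 - ((w.1 - z.1) ^+ 2 + (w.2 - z.2) ^+ 2)) ^+ 2.

(** The gradient of the cutoff at [w] is [dcutoff z w] times [w - z]. *)
Definition dcutoff (z w : R * R) : R :=
  - 4 * Num.max 0 (1 - ((w.1 - z.1) ^+ 2 + (w.2 - z.2) ^+ 2)).

Lemma has_C1_cutoff z : has_C1 (cutoff z)
  (fun w => dcutoff z w * (w.1 - z.1)) (fun w => dcutoff z w * (w.2 - z.2)).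
Proof.
have h1 := has_C1B has_C1_fst (has_C1_cst z.1).
have h2 := has_C1B has_C1_snd (has_C1_cst z.2).
have h := has_C1B (has_C1_cst 1)
  (has_C1D (has_C1M h1 h1) (has_C1M h2 h2)).
have := has_C1_comp is_derive_sqr_pospart _ h; case.
  move=> s; apply: cvgM; first exact: cvg_cst.
  by apply: (@continuous_max _ _ (cst 0) id); [exact: cvg_cst|exact: cvg_id].
move=> d1 d2 c1 c2.
by apply: (has_C1_ext (And4 d1 d2 c1 c2)) => w; rewrite /cutoff /dcutoff ?expr2 //; ring.
Qed.

Lemma cutoff_ge0 z w : 0 <= cutoff z w.
Proof. exact: sqr_ge0. Qed.

Lemma cutoff_le1 z w : cutoff z w <= 1.
Proof.
rewrite /cutoff expr_le1 // ?ge_max ?ler01 ?le_max ?lexx //=.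
by rewrite gerBl addr_ge0 // sqr_ge0.
Qed.

Lemma dcutoff_le z w : `|dcutoff z w| <= 4.
Proof.
rewrite /dcutoff normrM normrN !ger0_norm ?le_max ?lexx //.
rewrite -[leRHS]mulr1 ler_pM2l // ge_max ler01 /=.
by rewrite gerBl addr_ge0 // sqr_ge0.
Qed.

Lemma cutoff_eq0 z w : 1 <= (w.1 - z.1) ^+ 2 \/ 1 <= (w.2 - z.2) ^+ 2 -> cutoff z w = 0.
Proof.
move=> h; rewrite /cutoff max_l ?expr0n //.
by rewrite subr_le0; have := sqr_ge0 (w.1 - z.1); have := sqr_ge0 (w.2 - z.2); case: h; lra.
Qed.

End C1_calculus.

(** * Mean value property of Cauchy-Riemann pairs *)

Section mean_value.
Context {R : realType}.
Local Notation area := (area R).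

Lemma continuous_bounded_box (f : R * R -> R) z h : continuous f ->
  exists2 M, 0 <= M & forall w, box z h w -> `|f w| <= M.
Proof.
move=> cf; have cf' : {within box z h, continuous f} by exact: continuous_subspaceT.
have /compact_bounded[M [_ mrt]] := continuous_compact cf' (compact_box z h).
exists (`|M| + 1); first by rewrite addr_ge0.
move=> w zw; apply: (mrt (`|M| + 1)); first by rewrite ltr_pwDr ?ler_norm.
by exists w.
Qed.

Lemma boxP (z w : R * R) h : box z h w <-> `|w.1 - z.1| <= h /\ `|w.2 - z.2| <= h.
Proof.
rewrite /box /= !in_itv /= !ler_distl; split=> -[/andP[a b] /andP[c d]]; split;
by apply/andP; split; lra.
Qed.

Lemma continuous_cutoff z : continuous (@cutoff R z).
Proof. exact: has_C1_continuous (has_C1_cutoff z). Qed.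

Section cauchy_riemann_pair.
Variables (h k hx hy : R * R -> R) (z : R * R).
Hypothesis h_C1 : has_C1 h hx hy.
Hypothesis k_C1 : has_C1 k (fun w => - hy w) hx.

Let f (l : R) (w : plane R) : R := cutoff z w * h (dilate z l w).

Let df (l : R) (w : plane R) : R := cutoff z w *
  ((w.1 - z.1) * hx (dilate z l w) + (w.2 - z.2) * hy (dilate z l w)).

Let f_derive l w : is_derive l (1 : R) (f ^~ w) (df l w).
Proof.
have d := has_C1_line z (w.1 - z.1, w.2 - z.2) l h_C1.
have d' := is_deriveZ (cutoff z w) d.
exact: d'.
Qed.

Let continuous_f l : continuous (f l : R * R -> R).
Proof.
have h1 := has_C1M (has_C1_cutoff z) (has_C1_dilate z l h_C1).
exact: has_C1_continuous h1.
Qed.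

(** Along the dilations about [z], the weighted average has derivative the
    integral of a divergence; radiality of the cutoff is what cancels the terms
    in which the cutoff is differentiated. *)
Let integral_df_eq0 l : l != 0 -> \int[area]_(w in square z) df l w = 0.
Proof.
move=> l0.
have kl := has_C1_dilate z l k_C1.
have h1 := has_C1B (@has_C1_fst R) (has_C1_cst z.1).
have h2 := has_C1B (@has_C1_snd R) (has_C1_cst z.2).
have e := has_C1M (has_C1_cutoff z) kl.
have p := has_C1M h1 e.
have q := has_C1M h2 e.
have side (c : R) : 1 <= (c + 1 - c) ^+ 2 /\ 1 <= (c - 1 - c) ^+ 2.
  by split; rewrite addrAC subrr add0r ?sqrrN expr1n.
have p' := has_C1M (has_C1_cst (l^-1)) p.
have q' := has_C1M (has_C1_cst (- l^-1)) q.
rewrite -[RHS](integral_divergence_eq0 _ _ _ _ _ _ z q' p') /=.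
- apply: eq_Rintegral => w _; rewrite /df; field; exact: l0.
- by move=> y; rewrite !cutoff_eq0 ?mul0r ?mulr0 //=; left; case: (side z.1).
- by move=> x; rewrite !cutoff_eq0 ?mul0r ?mulr0 //=; right; case: (side z.2).
Qed.

(* The range [-1, 2] contains a neighbourhood of [0, 1], the dilation factors in
   use; it keeps the dilated square inside [box z 2]. *)
Let df_bounded : exists M, 0 <= M /\
  forall l w, l \in `]-1, 2[ -> square z w -> `|df l w| <= M.
Proof.
case: h_C1 => _ _ cx cy.
have [M1 M10 h1] := continuous_bounded_box _ z 2 cx.
have [M2 M20 h2] := continuous_bounded_box _ z 2 cy.
exists (M1 + M2); split; first exact: addr_ge0.
move=> l w; rewrite in_itv /= => /andP[l1 l2] /boxP[w1 w2].
have bl (t : R) : `|t| <= 1 -> `|l * t| <= 2.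
  move=> t1; rewrite normrM -[leRHS]mulr1; apply: ler_pM => //.
  by rewrite ler_norml; apply/andP; split; lra.
have zw : box z 2 (dilate z l w).
  by apply/boxP; rewrite /dilate /=; split; rewrite addrAC subrr add0r; apply: bl.
rewrite /df normrM -[leRHS]mul1r; apply: ler_pM => //.
  by rewrite ger0_norm ?cutoff_ge0 ?cutoff_le1.
rewrite (le_trans (ler_normD _ _)) // !normrM; apply: lerD.
  by rewrite -[leRHS]mul1r; apply: ler_pM => //; apply: h1.
by rewrite -[leRHS]mul1r; apply: ler_pM => //; apply: h2.
Qed.

(** The average of [h] over the square dilated by [l] about [z] is independent
    of [l]: at [l = 1] it is the average of [h], at [l = 0] it is [h z]. *)
Lemma cauchy_riemann_mean_value :
  \int[area]_(w in square z) (cutoff z w * h w) =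
  h z * \int[area]_(w in square z) cutoff z w.
Proof.
have [M [M0 dfM]] := df_bounded.
pose D l := \int[area]_(w in square z) f l w.
have If l : area.-integrable (square z) (EFin \o f l).
  by apply: continuous_integrable_square; exact: continuous_f.
have IM : area.-integrable (square z) (EFin \o (fun=> M)).
  by apply: continuous_integrable_square => w; exact: cvg_cst.
have d1 l w : partial1of2 f l w = df l w.
  by rewrite partial1of2E; case: (f_derive l w).
have bound (l : R) (w : plane R) : `]-1, 2[%classic l -> square z w ->
    `|partial1of2 f l w| <= M by move=> l2 zw; rewrite d1; apply: dfM.
have dD (l : R) : l \in `]-1, 2[ ->
    is_derive l (1 : R) D (\int[area]_(w in square z) df l w).
  move=> l2.
  have DE := differentiation_under_integral (measurable_square z) l2
    (fun x _ => If x) (fun x y _ _ => @ex_derive _ _ _ _ _ _ _ (f_derive x y)) (fun=> M0) IM bound.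
  have Dd := derivable_under_integral (measurable_square z) l2
    (fun x _ => If x) (fun x y _ _ => @ex_derive _ _ _ _ _ _ _ (f_derive x y)) (fun=> M0) IM bound.
  apply: DeriveDef; first exact: Dd.
  rewrite -derive1E [LHS]DE; apply: eq_Rintegral => w _; exact: d1.
have in01 (l : R) : l \in `[0, 1] -> l \in `]-1, 2[.
  by rewrite !in_itv /= => /andP[? ?]; apply/andP; split; lra.
have cD : {within `[0, 1], continuous D}.
  by apply: derivable_within_continuous => l /in01 /dD [].
have [c] := MVT (@ltr01 R) (fun l l01 => dD l (in01 l (subset_itv_oo_cc l01))) cD.
rewrite in_itv /= => /andP[c0 _]; rewrite integral_df_eq0 ?gt_eqF // mul0r.
move=> /eqP; rewrite subr_eq0 => /eqP D10.
transitivity (D 1).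
  apply: eq_Rintegral => w _; rewrite /f /dilate; congr (_ * h _).
  by case: w => a b /=; rewrite !mul1r; congr (_, _); rewrite addrCA subrr addr0.
rewrite D10 -RintegralZl; last 2 first.
- exact: measurable_square.
- by apply: continuous_integrable_square; exact: continuous_cutoff.
apply: eq_Rintegral => w _; rewrite /f /dilate !mul0r !addr0 mulrC; congr (h _ * _).
by case: z.
Qed.

End cauchy_riemann_pair.

End mean_value.

(** * Harmonic functions and a weighted gradient estimate *)

Section gradient_estimate.
Context {R : realType}.
Local Notation area := (area R).

Lemma continuous_prod_ball (f : R * R -> R) (x y e : R) : continuous f -> 0 < e ->
  exists2 d : R, 0 < d & forall s t, `|s - x| < d -> `|t - y| < d ->
    `|f (x, y) - f (s, t)| < e.
Proof.
move=> cf e0; have /cvgrPdist_lt /(_ _ e0) /nbhs_ballP[d d0 h] := cf (x, y).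
exists d => // s t sx ty; apply: h; split => /=; rewrite -ball_normE /=.
  by rewrite distrC.
by rewrite distrC.
Qed.

(** Both mixed partials are limits of the same second difference quotient. *)
Lemma mixed_partials_eq (u ux uy uxx uxy uyx uyy : R * R -> R) :
  has_C1 u ux uy -> has_C1 ux uxx uxy -> has_C1 uy uyx uyy -> uxy =1 uyx.
Proof.
move=> [u1 u2 _ _] [_ ux2 _ cxy] [uy1 _ cyx _] [x y].
apply/eqP; rewrite -subr_eq0 -normr_eq0; apply/negPn/negP => ne.
set a := `|_| in ne; have a0 : 0 < a by rewrite lt_neqAle eq_sym ne normr_ge0.
have a2 : 0 < a / 2 by rewrite divr_gt0.
have [d1 d10 h1] := continuous_prod_ball _ x y _ cxy a2.
have [d2 d20 h2] := continuous_prod_ball _ x y _ cyx a2.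
pose h : R := Num.min d1 d2 / 2.
have h0 : 0 < h by rewrite divr_gt0 // lt_min d10 d20.
have [hd1 hd2] : h < d1 /\ h < d2.
  have m0 : 0 < Num.min d1 d2 by rewrite lt_min d10 d20.
  have : Num.min d1 d2 <= d1 /\ Num.min d1 d2 <= d2 by rewrite !ge_min !lexx orbT.
  by rewrite /h => -[? ?]; split; lra.
have [b b1 eb] := MVT_everywhere (fun s => u (s, y + h) - u (s, y))
  (fun s => ux (s, y + h) - ux (s, y)) (fun s => is_deriveB (u1 s (y + h)) (u1 s y)) x (x + h).
have [c c1 ec] := MVT_everywhere _ _ (ux2 b) y (y + h).
have [b' b'1 eb'] := MVT_everywhere (fun t => u (x + h, t) - u (x, t))
  (fun t => uy (x + h, t) - uy (x, t)) (fun t => is_deriveB (u2 (x + h) t) (u2 x t)) y (y + h).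
have [c' c'1 ec'] := MVT_everywhere _ _ (uy1 ^~ b') x (x + h).
move: b1 c1 b'1 c'1 eb ec eb' ec' => /=.
rewrite !(addrAC _ h) !subrr !add0r (gtr0_norm h0) => b1 c1 b'1 c'1 eb ec eb' ec'.
have exy : uxy (b, c) = uyx (c', b').
  have hn0 : h != 0 by rewrite gt_eqF.
  have : uxy (b, c) * h * h = uyx (c', b') * h * h by rewrite -ec -ec' -eb -eb'; ring.
  by move=> /(mulIf hn0) /(mulIf hn0).
have e1 := h1 _ _ (le_lt_trans b1 hd1) (le_lt_trans c1 hd1).
have e2 := h2 _ _ (le_lt_trans c'1 hd2) (le_lt_trans b'1 hd2).
suff : a < a by rewrite ltxx.
rewrite {1}/a (_ : uxy (x, y) - uyx (x, y) =
  (uxy (x, y) - uxy (b, c)) - (uyx (x, y) - uyx (c', b'))); last by rewrite exy; ring.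
by rewrite (le_lt_trans (ler_normB _ _)) // (splitr a) ltrD.
Qed.

(** With these relations [u_x] and [- u_y] satisfy the Cauchy-Riemann equations. *)
Lemma real_harmonic_partials (u : R * R -> R) : real_harmonic u ->
  exists ux uy uxx uxy, [/\ has_C1 u ux uy, has_C1 ux uxx uxy
    & has_C1 uy uxy (fun w => - uxx w)].
Proof.
move=> [[/class_C1_has_C1 h /class_C1_has_C1 h1 /class_C1_has_C1 h2] lap].
exists ('D_(1, 0) u), ('D_(0, 1) u), ('D_(1, 0) ('D_(1, 0) u)), ('D_(0, 1) ('D_(1, 0) u)).
split; [exact: h|exact: h1|].
apply: (has_C1_ext h2) => w; first by [].
  by rewrite (mixed_partials_eq _ _ _ _ _ _ _ h h1 h2).
by apply/eqP; rewrite -addr_eq0 addrC; apply/eqP; exact: lap.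
Qed.

Lemma integral_cutoff_ge z : 1 / 4 <= \int[area]_(w in square z) cutoff z w.
Proof.
have Ic : area.-integrable (square z) (EFin \o @cutoff R z).
  by apply: continuous_integrable_square; exact: continuous_cutoff.
rewrite -lee_fin /Rintegral fineK; last by apply: integrable_fin_num => //; exact: measurable_square.
have sub : box z (1 / 2) `<=` square z.
  by move=> w /boxP[w1 w2]; apply/boxP; split; lra.
apply: (@le_trans _ _ (\int[area]_(w in box z (1/2)) (cutoff z w)%:E)%E); last first.
  apply: ge0_subset_integral => //; [exact: measurable_box|exact: measurable_square|..].
  - by case/integrableP: Ic.
  - by move=> w _; rewrite lee_fin cutoff_ge0.
apply: (@le_trans _ _ (\int[area]_(w in box z (1/2)) (cst (1 / 4)%:E w))%E).
  rewrite integral_cst; last exact: measurable_box.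
  rewrite [X in (_ * X)%E](area_box z (1/2)) ?divr_ge0 // -EFinM lee_fin.
  lra.
apply: ge0_le_integral => //; first exact: measurable_box.
- by move=> w _; rewrite lee_fin; lra.
- apply: measurable_funTS; apply/measurable_EFinP.
  by apply: continuous_measurable_plane; exact: continuous_cutoff.
move=> w /boxP[/ler_normlP[a b] /ler_normlP[c d]]; rewrite lee_fin /cutoff.
have s1 : (w.1 - z.1) ^+ 2 <= 1 / 4 by nra.
have s2 : (w.2 - z.2) ^+ 2 <= 1 / 4 by nra.
rewrite max_r; first nra.
by lra.
Qed.

End gradient_estimate.

Section wave_estimate.
Context {R : realType}.
Local Notation area := (area R).

(** The real part of [(c - i d) exp ((a - i b) (w.1 + i w.2) + e + i f)]. *)
Definition wave (a b e f c d : R) (w : R * R) : R :=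
  expR (a * w.1 + b * w.2 + e) *
  (c * cos (- b * w.1 + a * w.2 + f) + d * sin (- b * w.1 + a * w.2 + f)).

Lemma has_C1_wave a b e f c d : has_C1 (wave a b e f c d)
  (wave a b e f (a * c - b * d) (a * d + b * c))
  (wave a b e f (b * c + a * d) (b * d - a * c)).
Proof.
have hl := has_C1_affine a b e.
have ht := has_C1_affine (- b) a f.
have hE := has_C1_comp (@is_derive_expR R) (@continuous_expR R) hl.
have cNs : continuous (fun t : R => - sin t).
  by move=> t; apply: cvgN; exact: continuous_sin.
have hc := has_C1_comp (@is_derive_cos R) cNs ht.
have hs := has_C1_comp (@is_derive_sin R) (@continuous_cos R) ht.
have h := has_C1M hE (has_C1D
  (has_C1M (has_C1_cst c) hc) (has_C1M (has_C1_cst d) hs)).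
by apply: (has_C1_ext h) => w; rewrite /wave; first [by []|ring].
Qed.

Lemma wave_le a b e f c d w :
  `|wave a b e f c d w| <= (`|c| + `|d|) * expR (a * w.1 + b * w.2 + e).
Proof.
rewrite /wave normrM (ger0_norm (expR_ge0 _)) mulrC ler_wpM2r ?expR_ge0 //.
rewrite (le_trans (ler_normD _ _)) // !normrM.
by apply: lerD; rewrite -[leRHS]mulr1 ler_wpM2l // ler_norml ?cos_geN1 ?cos_le1 ?sin_geN1 ?sin_le1.
Qed.

Lemma real_harmonic_wave a b e f c d : real_harmonic (wave a b e f c d).
Proof.
have h c' d' := has_C1_wave a b e f c' d'.
have [ex ey] := has_C1_D (h c d).
split; first by split; rewrite ?ex ?ey; apply: has_C1_class_C1 (h _ _).
move=> w; rewrite /laplacian ex ey.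
have [/(congr1 (@^~ w)) /= -> _] := has_C1_D (h (a * c - b * d) (a * d + b * c)).
have [_ /(congr1 (@^~ w)) /= ->] := has_C1_D (h (b * c + a * d) (b * d - a * c)).
by rewrite /wave; ring.
Qed.

Definition nsq (w : R * R) : R := w.1 ^+ 2 + w.2 ^+ 2.

Lemma continuous_nsq : continuous nsq.
Proof.
apply: has_C1_continuous (has_C1D
  (has_C1M (@has_C1_fst R) (@has_C1_fst R))
  (has_C1M (@has_C1_snd R) (@has_C1_snd R))).
Qed.

Definition damped (alpha : R) (u : R * R -> R) (w : R * R) : R :=
  `|u w| * expR (- (alpha / 2) * nsq w).

Lemma continuous_damped alpha u : continuous u -> continuous (damped alpha u).
Proof.
move=> cu w; apply: cvgM.
  by apply: (@continuous_comp _ _ _ u (@Num.norm _ R)); [exact: cu|exact: norm_continuous].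
apply: (@continuous_comp _ _ _ (fun w => - (alpha / 2) * nsq w) expR).
  by apply: cvgM; [exact: cvg_cst|exact: continuous_nsq].
exact: continuous_expR.
Qed.

(** The derivative of [u] along [(c, - d)] at [z] is the value at [z] of the
    real part of the holomorphic function [(u_x - i u_y) (c - i d) exp (- alpha
    conj z (w - z))].  Its mean value over the square, integrated by parts,
    only involves [u]; the exponential factor turns the weight at [w] into
    the weight at [z]. *)
Lemma gradient_bound (alpha : R) u ux uy uxx uxy (z : R * R) (c d : R) : 0 < alpha ->
  has_C1 u ux uy -> has_C1 ux uxx uxy -> has_C1 uy uxy (fun w => - uxx w) ->
  `|c * ux z - d * uy z| <= 4 * ((`|c| + `|d|) * (8 + 2 * alpha * (`|z.1| + `|z.2|))) *
    expR (alpha + alpha / 2 * nsq z) *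
    \int[area]_(w in square z) damped alpha u w.
Proof.
move=> a0 hu hx hy; pose a := - (alpha * z.1); pose b := - (alpha * z.2).
(* These phases make the exponential equal to [1] at [z]. *)
pose e := alpha * nsq z.
pose f := b * z.1 - a * z.2.
pose A := wave a b e f c d; pose B := wave a b e f (- d) c.
have hA : has_C1 A _ _ := has_C1_wave a b e f c d.
have hB : has_C1 B _ _ := has_C1_wave a b e f (- d) c.
(* Real and imaginary part of a product of two holomorphic functions. *)
have [hhx [hhy [hh hk]]] : exists hhx hhy,
    has_C1 (fun w => ux w * A w + uy w * B w) hhx hhy /\
    has_C1 (fun w => ux w * B w - uy w * A w) (fun w => - hhy w) hhx.
  do 2 eexists; split.
    exact: (has_C1D (has_C1M hx hA) (has_C1M hy hB)).
  have hk := has_C1B (has_C1M hx hB) (has_C1M hy hA).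
  by apply: (has_C1_ext hk) => w; rewrite /A /B /wave; first [by []|ring].
have mv : \int[area]_(w in square z) (cutoff z w * (ux w * A w + uy w * B w)) =
    (c * ux z - d * uy z) * \int[area]_(w in square z) cutoff z w.
  rewrite (cauchy_riemann_mean_value _ _ _ _ z hh hk).
    congr (_ * _); rewrite /A /B /wave.
    have -> : a * z.1 + b * z.2 + e = 0 by rewrite /a /b /e /nsq; ring.
    have -> : - b * z.1 + a * z.2 + f = 0 by rewrite /f; ring.
    by rewrite expR0 cos0 sin0; ring.
have hp := has_C1M (has_C1_cutoff z) (has_C1M hA hu).
have hq := has_C1M (has_C1_cutoff z) (has_C1M hB hu).
have side (t : R) : 1 <= (t + 1 - t) ^+ 2 /\ 1 <= (t - 1 - t) ^+ 2.
  by split; rewrite addrAC subrr add0r ?sqrrN expr1n.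
have ibp := integral_divergence_eq0 _ _ _ _ _ _ z hp hq.
pose Ax := wave a b e f (a * c - b * d) (a * d + b * c).
pose psi w := dcutoff z w * (w.1 - z.1) * A w + dcutoff z w * (w.2 - z.2) * B w +
  2 * cutoff z w * Ax w.
have cu := has_C1_continuous hu.
have ceta := @continuous_cutoff R z.
have cpsi : continuous (fun w => u w * psi w).
  move=> w; apply: cvgM; first exact: cu.
  apply: cvgD; first apply: cvgD.
  - apply: cvgM; last exact: has_C1_continuous hA w.
    by case: (has_C1_cutoff z) => _ _ + _; apply.
  - apply: cvgM; last exact: has_C1_continuous hB w.
    by case: (has_C1_cutoff z) => _ _ _; apply.
  - apply: cvgM; last exact: has_C1_continuous (has_C1_wave _ _ _ _ _ _) w.
    by apply: cvgM; [exact: cvg_cst|exact: ceta].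
have Ipsi := continuous_integrable_square _ z cpsi.
have cdamp := continuous_damped alpha u cu.
have Idamp := continuous_integrable_square _ z cdamp.
have parts : \int[area]_(w in square z) (cutoff z w * (ux w * A w + uy w * B w)) =
    - \int[area]_(w in square z) (u w * psi w).
  rewrite -[LHS]subr0 -[X in _ - X]ibp.
  - rewrite -RintegralB; last 3 first.
    + exact: measurable_square.
    + apply: continuous_integrable_square.
      exact: has_C1_continuous (has_C1M (has_C1_cutoff z) hh).
    + apply: continuous_integrable_square => w; apply: cvgD.
        by case: hp => _ _ + _; apply.
      by case: hq => _ _ _; apply.
    rewrite -[RHS]mulN1r -[RHS]RintegralZl //; last exact: measurable_square.
    by apply: eq_Rintegral => w _; rewrite /psi /A /B /Ax /wave; ring.
  - by move=> y; rewrite !cutoff_eq0 ?mul0r //=; left; case: (side z.1).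
  - by move=> x; rewrite !cutoff_eq0 ?mul0r //=; right; case: (side z.2).
set K := (`|c| + `|d|) * (8 + 2 * alpha * (`|z.1| + `|z.2|)).
have C0 : 0 <= `|c| + `|d| by rewrite addr_ge0.
have K0 : 0 <= K.
  by rewrite mulr_ge0 // addr_ge0 // mulr_ge0 ?addr_ge0 // mulr_ge0 // ltW.
have psi_le w : square z w ->
    `|u w * psi w| <= K * expR (alpha + alpha / 2 * nsq z) * damped alpha u w.
  move=> /boxP[w1 w2].
  (* [|w - z|^2 <= 2] on the square, and [2 z.w = |z|^2 + |w|^2 - |w - z|^2]. *)
  have Ew : expR (a * w.1 + b * w.2 + e) <=
      expR (alpha + alpha / 2 * nsq z) * expR (- (alpha / 2) * nsq w).
    rewrite -expRD ler_expR /a /b /e /nsq.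
    move: w1 w2; rewrite !ler_norml => /andP[? ?] /andP[? ?].
    have : alpha * ((w.1 - z.1) ^+ 2 + (w.2 - z.2) ^+ 2) <= alpha * 2.
      by rewrite ler_pM2l //; nra.
    by lra.
  set E := expR _ in Ew; set E' := _ * expR _ in Ew.
  have ale : `|a| = alpha * `|z.1| by rewrite normrN normrM gtr0_norm.
  have ble : `|b| = alpha * `|z.2| by rewrite normrN normrM gtr0_norm.
  have AxE : `|Ax w| <= (`|a| + `|b|) * (`|c| + `|d|) * E.
    apply: le_trans (wave_le _ _ _ _ _ _ _) _; rewrite ler_wpM2r ?expR_ge0 //.
    apply: (@le_trans _ _ ((`|a| * `|c| + `|b| * `|d|) + (`|a| * `|d| + `|b| * `|c|))).
      rewrite -!normrM; apply: lerD; first exact: ler_normB.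
      exact: ler_normD.
    by rewrite le_eqVlt; apply/orP; left; apply/eqP; ring.
  have AE : `|A w| <= (`|c| + `|d|) * E by exact: wave_le.
  have BE : `|B w| <= (`|c| + `|d|) * E.
    by apply: le_trans (wave_le _ _ _ _ _ _ _) _; rewrite normrN (addrC `|d|).
  have cut (w' t s : R) : `|w'| <= 1 -> `|t| <= s -> `|dcutoff z w * w' * t| <= 4 * s.
    move=> w'1 ts; rewrite normrM; apply: ler_pM => //.
    rewrite (normrM (dcutoff z w)) -[leRHS]mulr1; apply: ler_pM => //.
    exact: dcutoff_le.
  have psiE : `|psi w| <= K * E.
    apply: (@le_trans _ _ (4 * ((`|c| + `|d|) * E) + 4 * ((`|c| + `|d|) * E) +
       2 * ((`|a| + `|b|) * (`|c| + `|d|) * E))); last first.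
      by rewrite le_eqVlt ale ble /K; apply/orP; left; apply/eqP; ring.
    apply: le_trans (ler_normD _ _) _; apply: lerD.
      by apply: le_trans (ler_normD _ _) _; apply: lerD; apply: cut.
    rewrite normrM; apply: ler_pM => //.
    rewrite normrM !ger0_norm ?cutoff_ge0 // -[leRHS]mulr1.
    by rewrite ler_pM2l // cutoff_le1.
  rewrite normrM /damped [leRHS](_ : _ = `|u w| * (K * E')); last by rewrite /E'; ring.
  by rewrite ler_wpM2l // (le_trans psiE) // ler_wpM2l.
have c0 := integral_cutoff_ge z.
have : `|c * ux z - d * uy z| * (1 / 4) <=
    K * expR (alpha + alpha / 2 * nsq z) * \int[area]_(w in square z) damped alpha u w.
  apply: (@le_trans _ _ `|(c * ux z - d * uy z) * \int[area]_(w in square z) cutoff z w|).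
    by rewrite normrM ler_wpM2l // (le_trans c0) // ler_norm.
  rewrite -mv parts normrN -[leRHS]RintegralZl //; last exact: measurable_square.
  apply: le_trans (le_normr_Rintegral _ Ipsi) _; first exact: measurable_square.
  apply: le_Rintegral; [exact: measurable_square|exact: integrable_norm| |exact: psi_le].
  apply: continuous_integrable_square => w; apply: cvgM; first exact: cvg_cst.
  exact: cdamp.
by set J := Rintegral _ _ _; set e1 := expR _; lra.
Qed.

End wave_estimate.

(** * Pointwise bound of harmonic functions by weighted integrals *)

Section damped_integrals.
Context {R : realType}.
Local Notation area := (area R).
Variables (alpha p : R).
Hypotheses (alpha0 : 0 < alpha) (p1 : 1 <= p).

Definition energy (u : R * R -> R) (w : R * R) : R := damped alpha u w `^ p.

Lemma measurable_energy (u : R * R -> R) : continuous u ->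
  measurable_fun setT (energy u : plane R -> R).
Proof.
move=> cu; apply: (@measurableT_comp _ _ _ _ _ _ (fun x : R => x `^ p) _ (damped alpha u)).
  exact: measurable_powR.
by apply: continuous_measurable_plane; exact: continuous_damped.
Qed.

Lemma damped_ge0 (u : R * R -> R) w : 0 <= damped alpha u w.
Proof. by rewrite mulr_ge0 ?expR_ge0. Qed.

(** Jensen's inequality in the form needed, from [t <= A + A^(1 - p) t^p]. *)
Lemma integral_damped_le u z (A : R) : continuous u -> 0 < A ->
  (\int[area]_(w in square z) (energy u w)%:E <= (A `^ p)%:E)%E ->
  \int[area]_(w in square z) damped alpha u w <= 5 * A.
Proof.
move=> cu A0 uA.
have Id := continuous_integrable_square _ z (continuous_damped alpha u cu).
have mE : measurable_fun (square z) (fun w => (energy u w)%:E).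
  by apply: measurable_funTS; apply/measurable_EFinP; exact: measurable_energy.
have pw (t : R) : 0 <= t -> t <= A + A `^ (1 - p) * t `^ p.
  move=> t0; have [tA|At] := leP t A.
    by rewrite (le_trans tA) // lerDl mulr_ge0 // powR_ge0.
  have {}t0 : 0 < t by exact: lt_trans A0 At.
  apply: (@le_trans _ _ (A `^ (1 - p) * t `^ p)); last by rewrite lerDr ltW.
  have -> : t `^ p = t `^ (p - 1) * t.
    rewrite -[X in _ * X]powRr1 ?(ltW t0) // -powRD ?subrK //.
    by rewrite (gt_eqF t0) implybT.
  rewrite mulrA ler_peMl ?(ltW t0) //.
  rewrite -(opprB p) powRN -ler_pdivrMl ?invr_gt0 ?powR_gt0 // mulr1 invrK.
  by apply: ge0_ler_powR; rewrite ?nnegrE ?subr_ge0 // ltW.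
rewrite -lee_fin /Rintegral fineK; last first.
  by apply: integrable_fin_num => //; exact: measurable_square.
apply: (@le_trans _ _ (\int[area]_(w in square z) (A%:E + (A `^ (1 - p))%:E * (energy u w)%:E))%E).
  apply: ge0_le_integral => //.
  - exact: measurable_square.
  - by move=> w _; rewrite lee_fin damped_ge0.
  - by case/integrableP: Id.
  - apply: emeasurable_funD; first exact: measurable_cst.
    exact: measurable_funeM mE.
  - by move=> w _; rewrite -EFinM -EFinD lee_fin pw ?damped_ge0.
rewrite ge0_integralD //=; last 4 first.
- exact: measurable_square.
- by move=> w _; rewrite lee_fin ltW.
- by move=> w _; rewrite mule_ge0 // lee_fin ?powR_ge0.
- exact: measurable_funeM mE.
rewrite integral_cst; last exact: measurable_square.
rewrite [X in (_ * X + _)%E](area_box z 1) ?ler01 // ge0_integralZl //; last 3 first.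
- exact: measurable_square.
- by move=> w _; rewrite lee_fin powR_ge0.
- by rewrite lee_fin powR_ge0.
apply: (@le_trans _ _ (A%:E * (4 * 1 ^+ 2)%:E + (A `^ (1 - p))%:E * (A `^ p)%:E)%E).
  by apply: leeD => //; apply: lee_wpmul2l => //; rewrite lee_fin powR_ge0.
rewrite -!EFinM -EFinD lee_fin -powRD; last by rewrite (gt_eqF A0) implybT.
by rewrite subrK powRr1 ?(ltW A0) //; lra.
Qed.

(** On a set where the Gaussian weight is bounded below it can be dropped; as
    [p >= 1], the constant may then be moved inside the power. *)
Lemma integral_energy_sub u z (A r : R) (D : set (plane R)) :
  continuous u -> measurable D -> 0 <= r -> 0 < A ->
  (forall w, D w -> nsq (w - z) <= r) ->
  (\int[area]_w (energy u w * expR (- (alpha / 8) * nsq (w - z)))%:E <= (A `^ p)%:E)%E ->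
  (\int[area]_(w in D) (energy u w)%:E <= ((expR (alpha / 8 * r) * A) `^ p)%:E)%E.
Proof.
move=> cu mD r0 A0 Dr uA.
have mG : measurable_fun setT (fun w : plane R => (energy u w * expR (- (alpha / 8) * nsq (w - z)))%:E).
  apply/measurable_EFinP; apply: measurable_funM; first exact: measurable_energy.
  apply: continuous_measurable_plane => w.
  apply: (@continuous_comp _ _ _ (fun w : R * R => - (alpha / 8) * nsq (w - z)) expR).
    apply: cvgM; first exact: cvg_cst.
    apply: (@continuous_comp _ _ _ (fun w : R * R => w - z) nsq); last exact: continuous_nsq.
    by apply: (@cvgB _ (R * R)%type); [exact: cvg_id|exact: cvg_cst].
  exact: continuous_expR.
have G0 w : (0 <= (energy u w * expR (- (alpha / 8) * nsq (w - z)))%:E)%E.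
  by rewrite lee_fin mulr_ge0 ?powR_ge0 ?expR_ge0.
apply: (@le_trans _ _ (\int[area]_(w in D)
    ((expR (alpha / 8 * r))%:E * (energy u w * expR (- (alpha / 8) * nsq (w - z)))%:E))%E).
  apply: ge0_le_integral => //.
  - by move=> w _; rewrite lee_fin powR_ge0.
  - by apply: measurable_funTS; apply/measurable_EFinP; exact: measurable_energy.
  - by apply: measurable_funeM; exact: measurable_funTS mG.
  move=> w Dw; rewrite -EFinM lee_fin mulrCA -expRD ler_peMr ?powR_ge0 //.
  rewrite -expR0 ler_expR mulNr -mulrBr mulr_ge0 //; first by rewrite divr_ge0 // ltW.
  by rewrite subr_ge0; exact: Dr.
rewrite ge0_integralZl //; [|exact: measurable_funTS mG].
rewrite powRM ?expR_ge0 ?(ltW A0) // EFinM.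
apply: (@le_trans _ _ ((expR (alpha / 8 * r))%:E * (A `^ p)%:E)%E).
  apply: lee_wpmul2l; first by rewrite lee_fin expR_ge0.
  apply: le_trans uA; apply: ge0_subset_integral => //.
apply: lee_wpmul2r; first by rewrite lee_fin powR_ge0.
rewrite lee_fin -[leLHS]powRr1 ?expR_ge0 //.
apply: ler_powR => //; rewrite -expR0 ler_expR.
by rewrite mulr_ge0 // divr_ge0 // ltW.
Qed.

Lemma gradient_le u ux uy uxx uxy (z : R * R) (c d A : R) : 0 < A ->
  has_C1 u ux uy -> has_C1 ux uxx uxy -> has_C1 uy uxy (fun w => - uxx w) ->
  (\int[area]_(w in square z) (energy u w)%:E <= (A `^ p)%:E)%E ->
  `|c * ux z - d * uy z| <= 20 * ((`|c| + `|d|) * (8 + 2 * alpha * (`|z.1| + `|z.2|))) *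
    expR (alpha + alpha / 2 * nsq z) * A.
Proof.
move=> A0 hu hx hy uA.
have cu := has_C1_continuous hu.
have K0 : 0 <= 4 * ((`|c| + `|d|) * (8 + 2 * alpha * (`|z.1| + `|z.2|))) *
    expR (alpha + alpha / 2 * nsq z).
  rewrite mulr_ge0 ?expR_ge0 // mulr_ge0 // mulr_ge0 ?addr_ge0 //.
  by rewrite mulr_ge0 ?addr_ge0 // mulr_ge0 // ltW.
apply: le_trans (gradient_bound _ _ _ _ _ _ z c d alpha0 hu hx hy) _.
apply: le_trans (ler_wpM2l K0 (integral_damped_le _ _ _ cu A0 uA)) _.
by rewrite le_eqVlt; apply/orP; left; apply/eqP; ring.
Qed.

End damped_integrals.

Section origin.
Context {R : realType}.
Local Notation area := (area R).
Variables (alpha p : R).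
Hypotheses (alpha0 : 0 < alpha) (p1 : 1 <= p).
Local Notation energy := (energy alpha p).

(** Comparison form of the mean value theorem, used with [g] an explicit
    antiderivative of a bound of [|f'|]. *)
Lemma MVT_le (f df g dg : R -> R) :
  (forall s, is_derive s (1 : R) f (df s)) -> (forall s, is_derive s (1 : R) g (dg s)) ->
  (forall s, 0 <= s <= 1 -> `|df s| <= dg s) -> `|f 1 - f 0| <= g 1 - g 0.
Proof.
move=> fdf gdg fg.
have key (h dh : R -> R) : (forall s, is_derive s (1 : R) h (dh s)) ->
    (forall s, 0 <= s <= 1 -> 0 <= dh s) -> h 0 <= h 1.
  move=> hdh h0; have ch : continuous h.
    by move=> x; apply/differentiable_continuous/derivable1_diffP; case: (hdh x).
  have [c c01 e] := MVT ltr01 (fun x _ => hdh x) (continuous_subspaceT ch).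
  rewrite -subr_ge0 e subr0 mulr1; apply: h0.
  by move: c01; rewrite in_itv /= => /andP[a b]; rewrite !ltW.
have k1 : g 0 - f 0 <= g 1 - f 1.
  apply: (key (fun s => g s - f s) (fun s => dg s - df s)).
  by move=> s /fg; rewrite ler_norml subr_ge0 => /andP[].
have k2 : g 0 + f 0 <= g 1 + f 1.
  apply: (key (fun s => g s + f s) (fun s => dg s + df s)).
  by move=> s /fg; rewrite ler_norml -lerBlDr sub0r lerNl => /andP[]; rewrite lerNl.
by rewrite ler_norml; apply/andP; split; lra.
Qed.

Lemma has_C1_ray {u ux uy} (w : R * R) (t : R) : has_C1 u ux uy ->
  is_derive t (1 : R) (fun s => u (s * w.1, s * w.2))
   (w.1 * ux (t * w.1, t * w.2) + w.2 * uy (t * w.1, t * w.2)).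
Proof.
move=> hu; have := has_C1_line (0, 0) w t hu => /=; rewrite !add0r.
by under eq_fun do rewrite !add0r.
Qed.

Lemma integral_le_mono (f : plane R -> R) (D E : set (plane R)) :
  measurable D -> measurable E -> measurable_fun setT f -> (forall w, 0 <= f w) ->
  D `<=` E -> (\int[area]_(w in D) (f w)%:E <= \int[area]_(w in E) (f w)%:E)%E.
Proof.
move=> mD mE mf f0 DE; apply: ge0_subset_integral => //.
  by apply: measurable_funTS; apply/measurable_EFinP.
by move=> w _; rewrite lee_fin.
Qed.

(** Near the origin weights are harmless: by the gradient bound [u] varies little
    on the unit square, so [u (0, 0)] is close to the average of [u]. *)
Lemma origin_bound : exists2 C : R, 0 <= C & forall u (A : R), 0 < A -> real_harmonic u ->
  (\int[area]_(w in box (0%R, 0%R) 3) (energy u w)%:E <= (A `^ p)%:E)%E -> `|u (0, 0)| <= C * A.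
Proof.
pose C1 : R := 20 * (2 * (8 + 4 * alpha)) * expR (2 * alpha).
have C10 : 0 <= C1.
  by rewrite mulr_ge0 ?expR_ge0 // mulr_ge0 // mulr_ge0 // addr_ge0 // mulr_ge0 // ltW.
exists (2 * expR alpha + C1); first by rewrite addr_ge0 // mulr_ge0 // expR_ge0.
move=> u A A0 /real_harmonic_partials [ux [uy [uxx [uxy [hu hx hy]]]]] uA.
have cu := has_C1_continuous hu.
have sub (z : R * R) : square (0, 0) z ->
    (\int[area]_(w in square z) (energy u w)%:E <= (A `^ p)%:E)%E.
  move=> /boxP[/= z1 z2]; apply: le_trans uA; apply: integral_le_mono.
  - exact: measurable_square.
  - exact: measurable_box.
  - exact: measurable_energy.
  - by move=> w; exact: powR_ge0.
  move=> w /boxP[w1 w2]; apply/boxP => /=.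
  by move: z1 z2 w1 w2; rewrite !ler_norml => /andP[? ?] /andP[? ?] /andP[? ?] /andP[? ?];
    split; apply/andP; split; lra.
have diff w : square (0, 0) w -> `|u w - u (0, 0)| <= C1 * A.
  move=> /boxP[/=]; rewrite !subr0 => w1 w2.
  have := @MVT_le (fun s => u (s * w.1, s * w.2)) _ (fun s => (C1 * A) * s) (fun=> C1 * A)
    (fun s => has_C1_ray w s hu).
  rewrite !mul0r !mul1r mulr0 mulr1 subr0 -surjective_pairing; apply.
    move=> s; apply: is_derive_quadratic => h.
    by rewrite [X in `|X|](_ : _ = 0) ?normr0 ?sqr_ge0 //; ring.
  move=> s /andP[s0 s1].
  have sc (t : R) : `|t| <= 1 -> `|s * t| <= 1.
    by move=> t1; rewrite normrM -[leRHS]mulr1; apply: ler_pM => //; rewrite ger0_norm.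
  have sw : square (0, 0) (s * w.1, s * w.2) by apply/boxP; rewrite /= !subr0; split; exact: sc.
  have := gradient_le _ _ alpha0 p1 _ _ _ _ _ _ w.1 (- w.2) _ A0 hu hx hy (sub _ sw).
  rewrite mulNr opprK => h; apply: le_trans h _; rewrite ler_wpM2r ?(ltW A0) // /C1 /=.
  have t1 := sc _ w1; have t2 := sc _ w2.
  have n2 : nsq (s * w.1, s * w.2) <= 2.
    rewrite /nsq /= -(real_normK (num_real (s * w.1))) -(real_normK (num_real (s * w.2))).
    have := exprn_ile1 2 (normr_ge0 _) t1; have := exprn_ile1 2 (normr_ge0 _) t2; lra.
  apply: ler_pM; last 2 first.
  - rewrite ler_wpM2l //; apply: ler_pM; rewrite ?addr_ge0 ?normrN //; last 2 first.
    + by lra.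
    + by rewrite lerD2l -mulrA [leRHS](_ : _ = 2 * (alpha * 2)); [rewrite ler_pM2l // ler_pM2l //; lra|ring].
    + by rewrite mulr_ge0 ?addr_ge0 // mulr_ge0 // ltW.
  - by rewrite ler_expR; have : alpha / 2 * nsq (s * w.1, s * w.2) <= alpha / 2 * 2;
      [rewrite ler_pM2l // divr_gt0|lra].
  - rewrite mulr_ge0 // mulr_ge0 ?addr_ge0 // mulr_ge0 ?addr_ge0 // mulr_ge0 // ltW //.
  - exact: expR_ge0.
have cdamp := continuous_damped alpha u cu.
have Ic (c : R) : area.-integrable (square (0, 0)) (EFin \o (fun=> c)).
  by apply: continuous_integrable_square => w; exact: cvg_cst.
have Id : area.-integrable (square (0, 0)) (EFin \o (fun w => expR alpha * damped alpha u w)).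
  by apply: continuous_integrable_square => w; apply: cvgM; [exact: cvg_cst|exact: cdamp].
have sq0 : square (0, 0) (0 : R, 0 : R) by apply/boxP; rewrite /= subrr normr0.
have : \int[area]_(w in square (0, 0)) (`|u (0, 0)| - C1 * A) <=
       \int[area]_(w in square (0, 0)) (expR alpha * damped alpha u w).
  apply: le_Rintegral => //; first exact: measurable_square.
  move=> w sw; have d := diff _ sw; rewrite /damped mulrCA -expRD.
  have : `|u (0, 0)| <= `|u w| + C1 * A.
    rewrite -[u (0, 0)](subKr (u w)) (le_trans (ler_normB _ _)) // lerD2l //.
  have e1 : 1 <= expR (alpha + - (alpha / 2) * nsq w).
    rewrite -[leLHS]expR0 ler_expR.
    have n2 : nsq w <= 2.
      move: sw => /boxP[/=]; rewrite !subr0 /nsq -(real_normK (num_real w.1)) -(real_normK (num_real w.2)) => t1 t2.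
      by have := exprn_ile1 2 (normr_ge0 _) t1; have := exprn_ile1 2 (normr_ge0 _) t2; lra.
    have : alpha / 2 * nsq w <= alpha / 2 * 2 by rewrite ler_pM2l // divr_gt0.
    by lra.
  have : `|u w| <= `|u w| * expR (alpha + - (alpha / 2) * nsq w) by rewrite ler_peMr.
  by lra.
rewrite Rintegral_cst; last exact: measurable_square.
rewrite [X in _ * fine X](area_box (0, 0) 1) ?ler01 //= RintegralZl; last 2 first.
- exact: measurable_square.
- exact: continuous_integrable_square.
have I5 := integral_damped_le _ _ p1 _ _ _ cu A0 (sub _ sq0).
have : expR alpha * \int[area]_(w in square (0, 0)) damped alpha u w <= expR alpha * (5 * A).
  by rewrite ler_wpM2l ?expR_ge0.
have : 0 <= expR alpha * A by rewrite mulr_ge0 ?expR_ge0 // ltW.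
by set X := Rintegral _ _ _; lra.
Qed.

End origin.

Section ray.
Context {R : realType}.
Local Notation area := (area R).
Variables (alpha p : R).
Hypotheses (alpha0 : 0 < alpha) (p1 : 1 <= p).
Local Notation energy := (energy alpha p).

(** On the segment from the origin to [z] the derivative at [s z] is at most a
    constant times [L (1 + s L) exp (alpha/4 |z|^2 (1 + s^2))], where [L] is the
    [l^1] norm of [z].  The factor [L (1 + s L)] is compared with the derivative
    of the exponent, a multiple of [s |z|^2]; this is where the loss in the gradient bound is
    compensated. *)
Lemma ray_bound u ux uy uxx uxy (z : R * R) (A : R) : 0 < A ->
  has_C1 u ux uy -> has_C1 ux uxx uxy -> has_C1 uy uxy (fun w => - uxx w) ->
  (\int[area]_w (energy u w * expR (- (alpha / 8) * nsq (w - z)))%:E <= (A `^ p)%:E)%E ->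
  `|u z - u (0, 0)| <= 20 * expR (3 * alpha / 2 + alpha / 4 * nsq z) * A *
    (8 * (`|z.1| + `|z.2|) * expR (alpha / 4) + (32 / alpha + 8) * expR (alpha / 4 * nsq z)).
Proof.
move=> A0 hu hx hy uA; set L := `|z.1| + `|z.2|.
have L0 : 0 <= L by rewrite addr_ge0.
have cu := has_C1_continuous hu.
have n0 : 0 <= nsq z by rewrite addr_ge0 ?sqr_ge0.
have LT : L ^+ 2 <= 2 * nsq z.
  rewrite /L /nsq -(real_normK (num_real z.1)) -(real_normK (num_real z.2)).
  by have := sqr_ge0 (`|z.1| - `|z.2|); lra.
have TL : nsq z <= L ^+ 2.
  rewrite /L /nsq -(real_normK (num_real z.1)) -(real_normK (num_real z.2)).
  have := mulr_ge0 (normr_ge0 z.1) (normr_ge0 z.2); lra.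
pose K := 20 * expR (3 * alpha / 2 + alpha / 4 * nsq z) * A.
have K0 : 0 <= K by rewrite mulr_ge0 ?(ltW A0) // mulr_ge0 // expR_ge0.
pose B s : R := K * (8 * L * expR (alpha / 4) * s +
  (32 / alpha + 8) * expR (alpha / 4 * nsq z * s ^+ 2)).
pose dB s : R := K * (8 * L * expR (alpha / 4) +
  (16 + 4 * alpha) * s * nsq z * expR (alpha / 4 * nsq z * s ^+ 2)).
have BdB s : is_derive s (1 : R) B (dB s).
  have d2 : is_derive s (1 : R) (fun t => t ^+ 2) (2 * s).
    apply: is_derive_quadratic => h.
    by rewrite [X in `|X|](_ : _ = h ^+ 2) ?ger0_norm ?sqr_ge0 //; ring.
  have d1 : is_derive s (1 : R) (fun t => 8 * L * expR (alpha / 4) * t) (8 * L * expR (alpha / 4)).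
    apply: is_derive_quadratic => h.
    by rewrite [X in `|X|](_ : _ = 0) ?normr0 ?sqr_ge0 //; ring.
  have de := @is_derive1_comp _ expR _ _ _ _ (is_derive_expR _) (is_deriveZ (alpha / 4 * nsq z) d2).
  have d := is_deriveZ K (is_deriveD d1 (is_deriveZ (32 / alpha + 8) de)).
  apply: (@is_derive_eq _ _ _ _ _ _ _ _ d).
  rewrite /dB /= /GRing.scale /=.
  by set E := expR _; field; rewrite gt_eqF.
have := @MVT_le _ (fun s => u (s * z.1, s * z.2)) _ B dB
  (fun s => has_C1_ray z s hu) BdB.
rewrite !mul0r !mul1r -surjective_pairing => h; apply: le_trans (h _) _; last first.
  rewrite /B -mulrBr -/K ler_wpM2l // expr1n !mulr1 mulr0 add0r lerBlDr lerDl.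
  by rewrite mulr_ge0 ?expR_ge0 // addr_ge0 // divr_ge0 // ltW.
move=> s /andP[s0 s1] {h}.
(* On the unit square about [s z], [|w - z|^2 <= 4 + 2 (1 - s)^2 |z|^2]. *)
pose As : R := expR (alpha / 8 * (4 + 2 * (1 - s) ^+ 2 * nsq z)) * A.
have As0 : 0 < As by rewrite mulr_gt0 ?expR_gt0.
have sA : (\int[area]_(w in square ((s * z.1)%R, (s * z.2)%R)) (energy u w)%:E <= (As `^ p)%:E)%E.
  apply: (integral_energy_sub _ _ alpha0 p1 _ _ _ _ _ cu) uA => //.
  - exact: measurable_square.
  - by rewrite addr_ge0 // mulr_ge0 // mulr_ge0 // sqr_ge0.
  move=> w /boxP[/=]; rewrite !ler_norml => /andP[a b] /andP[c d].
  have e1 : (w.1 - s * z.1) ^+ 2 <= 1 by nra.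
  have e2 : (w.2 - s * z.2) ^+ 2 <= 1 by nra.
  rewrite /nsq /=.
  have := sqr_ge0 ((w.1 - s * z.1) + (1 - s) * z.1).
  have := sqr_ge0 ((w.2 - s * z.2) + (1 - s) * z.2).
  lra.
have := gradient_le _ _ alpha0 p1 _ _ _ _ _ _ z.1 (- z.2) _ As0 hu hx hy sA.
rewrite mulNr opprK normrN => h; apply: le_trans h _ => /=.
rewrite -/L !normrM (ger0_norm s0) -mulrDr -/L.
have nS : nsq (s * z.1, s * z.2) = s ^+ 2 * nsq z by rewrite /nsq /=; ring.
rewrite nS.
have Ee : expR (alpha + alpha / 2 * (s ^+ 2 * nsq z)) * As <=
   expR (3 * alpha / 2 + alpha / 4 * nsq z) * A * expR (alpha / 4 * nsq z * s ^+ 2).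
  rewrite /As mulrA -expRD [leRHS]mulrAC -expRD ler_wpM2r ?(ltW A0) // ler_expR.
  have : alpha * nsq z * (s - s ^+ 2) >= 0.
    by rewrite mulr_ge0 ?mulr_ge0 // ?(ltW alpha0) // subr_ge0; nra.
  by lra.
have c0 : 0 <= 20 * (L * (8 + 2 * alpha * (s * L))).
  by rewrite mulr_ge0 // mulr_ge0 // addr_ge0 // mulr_ge0 // mulr_ge0 // ltW.
rewrite -mulrA; apply: le_trans (ler_wpM2l c0 Ee) _.
rewrite [leLHS](_ : _ = K * (L * (8 + 2 * alpha * (s * L)) * expR (alpha / 4 * nsq z * s ^+ 2))); last by rewrite /K; ring.
rewrite /dB ler_wpM2l //.
set E := expR (alpha / 4 * nsq z * s ^+ 2).
have E0 : 0 <= E by exact: expR_ge0.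
(* For [s L <= 1] the exponential is bounded; otherwise [L <= s L^2]. *)
have part1 : 8 * L * E <= 8 * L * expR (alpha / 4) + 16 * s * nsq z * E.
  have [sL|Ls] := leP (s * L) 1.
    apply: (@le_trans _ _ (8 * L * expR (alpha / 4))).
      rewrite ler_wpM2l ?mulr_ge0 // ler_expR -mulrA -[leRHS]mulr1 ler_wpM2l //.
        by rewrite divr_ge0 // ltW.
      apply: (@le_trans _ _ (L ^+ 2 * s ^+ 2)); first by rewrite ler_wpM2r ?sqr_ge0.
      by rewrite -exprMn mulrC expr_le1 // mulr_ge0.
    by rewrite lerDl !mulr_ge0.
  apply: (@le_trans _ _ (16 * s * nsq z * E)).
    rewrite ler_wpM2r //.
    apply: (@le_trans _ _ (8 * L * (s * L))); first by rewrite ler_peMr ?mulr_ge0 // ltW.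
    have : s * L ^+ 2 <= s * (2 * nsq z) by rewrite ler_wpM2l.
    by lra.
  by rewrite lerDr !mulr_ge0 // expR_ge0.
have part2 : 2 * alpha * s * L ^+ 2 * E <= 4 * alpha * s * nsq z * E.
  rewrite ler_wpM2r //.
  have : (2 * alpha * s) * L ^+ 2 <= (2 * alpha * s) * (2 * nsq z).
    by rewrite ler_wpM2l // !mulr_ge0 // ltW.
  by lra.
by lra.
Qed.

(** The Gaussian decay [exp (- alpha/8 |w - z|^2)] costs at the
    origin, up to a constant, [exp (alpha/4 |z|^2)], half of what the weight
    [exp (- alpha/2 |z|^2)] at [z] provides. *)
Lemma growth_bound : exists2 C : R, 0 < C & forall u z (A : R), 0 < A -> real_harmonic u ->
  (\int[area]_w (energy u w * expR (- (alpha / 8) * nsq (w - z)))%:E <= (A `^ p)%:E)%E ->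
  damped alpha u z <= C * A.
Proof.
have [C0 C00 origin] := origin_bound _ _ alpha0 p1.
pose C2 : R := 8 * (1 + 4 / alpha) * expR (alpha / 4) + (32 / alpha + 8).
have a4 : 0 <= 4 / alpha by rewrite divr_ge0 // ltW.
have C20 : 0 < C2.
  by rewrite ltr_wpDl ?mulr_ge0 ?expR_ge0 ?addr_ge0 // ltr_wpDl // divr_ge0 // ltW.
exists (C0 * expR (9 * alpha / 2) + 20 * expR (3 * alpha / 2) * C2).
  by rewrite ltr_wpDl ?mulr_ge0 ?expR_ge0 // mulr_gt0 // mulr_gt0 // expR_gt0.
move=> u z A A0 harm uA.
have [ux [uy [uxx [uxy [hu hx hy]]]]] := real_harmonic_partials _ harm.
have cu := has_C1_continuous hu.
have n0 : 0 <= nsq z by rewrite addr_ge0 ?sqr_ge0.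
set T := expR (alpha / 4 * nsq z).
have T1 : 1 <= T by rewrite -[leLHS]expR0 ler_expR mulr_ge0 // divr_ge0 // ltW.
have TT : T * T = expR (alpha / 2 * nsq z) by rewrite -expRD; congr expR; field.
have u0 : `|u (0, 0)| <= C0 * (expR (9 * alpha / 2) * T * A).
  apply: (origin _ _ _ harm); first by rewrite mulr_gt0 ?mulr_gt0 ?expR_gt0.
  have := integral_energy_sub _ _ alpha0 p1 u z A (36 + 2 * nsq z) (box (0, 0) 3) cu _ _ A0 _ uA.
  rewrite -expRD (_ : alpha / 8 * (36 + 2 * nsq z) = 9 * alpha / 2 + alpha / 4 * nsq z); last by field.
  apply; first exact: measurable_box.
    by rewrite addr_ge0 // mulr_ge0.
  move=> w /boxP[/=]; rewrite !subr0 !ler_norml => /andP[a b] /andP[c d].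
  have e1 : w.1 ^+ 2 <= 9 by nra.
  have e2 : w.2 ^+ 2 <= 9 by nra.
  rewrite /nsq /=.
  have := sqr_ge0 (w.1 + z.1); have := sqr_ge0 (w.2 + z.2); lra.
have uz := ray_bound _ _ _ _ _ _ _ A0 hu hx hy uA.
have LT : `|z.1| + `|z.2| <= (1 + 4 / alpha) * T.
  have nT : nsq z <= 4 / alpha * T.
    rewrite -ler_pdivrMl ?divr_gt0 // invf_div mulrC.
    rewrite mulrC; apply: le_trans (expR_ge1Dx _) => /=.
    by rewrite lerDr.
  have : `|z.1| + `|z.2| <= 1 + nsq z.
    rewrite /nsq -(real_normK (num_real z.1)) -(real_normK (num_real z.2)).
    by have := sqr_ge0 (`|z.1| - 1 / 2); have := sqr_ge0 (`|z.2| - 1 / 2); lra.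
  by lra.
have step : 8 * (`|z.1| + `|z.2|) * expR (alpha / 4) + (32 / alpha + 8) * T <= C2 * T.
  have : 8 * expR (alpha / 4) * (`|z.1| + `|z.2|) <= 8 * expR (alpha / 4) * ((1 + 4 / alpha) * T).
    by rewrite ler_wpM2l // mulr_ge0 // expR_ge0.
  by rewrite /C2; lra.
rewrite expRD -/T in uz.
have {}uz : `|u z - u (0, 0)| <= 20 * expR (3 * alpha / 2) * C2 * A * (T * T).
  apply: le_trans uz _.
  apply: (@le_trans _ _ (20 * (expR (3 * alpha / 2) * T) * A * (C2 * T))).
    by rewrite ler_wpM2l // mulr_ge0 ?(ltW A0) // mulr_ge0 // mulr_ge0 // ?expR_ge0.
  by rewrite le_eqVlt; apply/orP; left; apply/eqP; ring.
have {}u0 : `|u (0, 0)| <= C0 * expR (9 * alpha / 2) * A * (T * T).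
  apply: le_trans u0 _.
  have : (C0 * expR (9 * alpha / 2) * A * T) * 1 <= (C0 * expR (9 * alpha / 2) * A * T) * T.
    rewrite ler_wpM2l // !mulr_ge0 ?expR_ge0 // ltW //.
  by lra.
have : `|u z| <= (C0 * expR (9 * alpha / 2) + 20 * expR (3 * alpha / 2) * C2) * A * (T * T).
  have : `|u z| <= `|u z - u (0, 0)| + `|u (0, 0)|.
    by rewrite -{1}(subrK (u (0, 0)) (u z)) ler_normD.
  by lra.
rewrite TT /damped => uzT.
have := ler_wpM2r (expR_ge0 (- (alpha / 2) * nsq z)) uzT.
by rewrite -[X in _ <= X -> _]mulrA -expRD -mulrDl subrr mul0r expR0 mulr1.
Qed.

End ray.

(** * Gaussians and Gaussian potentials of a measure *)

Section gaussian.
Context {R : realType}.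
Local Notation area := (area R).
Local Notation leb := (@lebesgue_measure R).

Definition gauss (c : R) (z w : R * R) : R := expR (- c * nsq (w - z)).

Lemma gauss_ge0 c z w : 0 <= gauss c z w.
Proof. exact: expR_ge0. Qed.

Lemma nsqBC (z w : R * R) : nsq (z - w) = nsq (w - z).
Proof. by rewrite /nsq /=; ring. Qed.

Lemma gaussC c z w : gauss c z w = gauss c w z.
Proof. by rewrite /gauss nsqBC. Qed.

Lemma measurable_nsqB : measurable_fun setT (fun x : plane R * plane R => nsq (x.2 - x.1)).
Proof.
have m1 : measurable_fun setT (fun x : plane R * plane R => x.2.1 - x.1.1).
  by apply: measurable_funB; [exact: (measurableT_comp measurable_fst measurable_snd)|
    exact: (measurableT_comp measurable_fst measurable_fst)].
have m2 : measurable_fun setT (fun x : plane R * plane R => x.2.2 - x.1.2).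
  by apply: measurable_funB; [exact: (measurableT_comp measurable_snd measurable_snd)|
    exact: (measurableT_comp measurable_snd measurable_fst)].
by apply: measurable_funD; apply: measurable_funX.
Qed.

Lemma measurable_gauss2 c : measurable_fun setT (fun x : plane R * plane R => gauss c x.1 x.2).
Proof.
apply: measurableT_comp; first exact: measurable_expR.
apply: measurable_funM; first exact: measurable_cst.
exact: measurable_nsqB.
Qed.

Lemma measurable_gauss c z : measurable_fun setT (gauss c z : plane R -> R).
Proof.
apply: (@measurableT_comp _ _ _ _ _ _ (fun x : plane R * plane R => gauss c x.1 x.2)
  _ (fun w => (z, w))); first exact: measurable_gauss2.
exact: measurable_pair1.
Qed.

Lemma measurable_gauss1 (c m : R) :
  measurable_fun setT (fun x : measurableTypeR R => (expR (- c * (x - m) ^+ 2))%:E).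
Proof.
  apply/measurable_EFinP;  apply: continuous_measurable_fun => x.
  apply: (@continuous_comp _ _ _ (fun x => - c * (x - m) ^+ 2) expR); last exact: continuous_expR.
  apply: cvgM; first exact: cvg_cst.
  apply: (@continuous_comp _ _ _ (fun x => x - m) (fun x => x ^+ 2)); last exact: sqr_continuous.
  by apply: cvgB; [exact: cvg_id|exact: cvg_cst].
Qed.

Lemma integral_gauss1 (c : R) : 0 < c -> exists2 K : R, 0 <= K &
  forall m, (\int[leb]_x (expR (- c * (x - m) ^+ 2))%:E = K%:E)%E.
Proof.
move=> c0; pose s := Num.sqrt (2 * c)^-1.
have s0 : 0 < s by rewrite sqrtr_gt0 invr_gt0 mulr_gt0.
have s2 : s ^+ 2 = (2 * c)^-1 by rewrite sqr_sqrtr // invr_ge0 mulr_ge0 // ltW.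
exists (normal_peak s)^-1; first by rewrite invr_ge0 normal_peak_ge0.
move=> m; have s_neq0 : s != 0 by rewrite gt_eqF.
have e (x : R) : normal_pdf m s x = normal_peak s * expR (- c * (x - m) ^+ 2).
  rewrite normal_pdfE // /normal_fun; congr (_ * expR _).
  by rewrite mulr2n s2; field; rewrite gt_eqF.
have pk := normal_peak_gt0 s_neq0.
have := integral_normal_pdf m s; under eq_integral do rewrite e EFinM.
rewrite ge0_integralZl //; [|exact: measurable_gauss1|by rewrite lee_fin ltW].
move=> h; have := congr1 (fun t => ((normal_peak s)^-1)%:E * t)%E h.
by rewrite muleA -EFinM mulVf ?gt_eqF // mul1e mule1.
Qed.

Lemma integral_gauss (c : R) : 0 < c -> exists2 K : R, 0 <= K &
  forall z, (\int[area]_w (gauss c z w)%:E <= K%:E)%E.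
Proof.
move=> c0; have [K K0 h] := integral_gauss1 _ c0.
exists (K * K) => [|z]; first exact: mulr_ge0.
have mg := measurable_gauss c z.
rewrite fubini_tonelli1; last 2 first.
- exact/measurable_EFinP.
- by move=> w; rewrite lee_fin gauss_ge0.
rewrite /fubini_F.
under eq_integral => x _.
  under eq_integral => y _.
    rewrite /gauss /nsq /= mulrDr expRD EFinM; over.
  rewrite ge0_integralZl //; [|exact: measurable_gauss1].
  rewrite h; over.
rewrite ge0_integralZr //; [|exact: measurable_gauss1].
by rewrite h -EFinM.
Qed.

End gaussian.

Section sigma_finite_copy.
Context d (T : measurableType d) (R : realType) (m : {measure set T -> \bar R}).

(** The same set function, carrying the sigma-finite structure that Tonelli's
    theorem asks for. *)
Definition sigma_finite_copy of sigma_finite setT m : set T -> \bar R := m.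

Variable sf : sigma_finite setT m.

HB.instance Definition _ := Measure.copy (sigma_finite_copy sf) m.

HB.instance Definition _ := Measure_isSigmaFinite.Build _ _ _ (sigma_finite_copy sf) sf.

End sigma_finite_copy.

Section potential.
Context {R : realType}.
Local Notation area := (area R).

Lemma sigma_finite_boxes (m : {measure set (plane R) -> \bar R}) :
  (forall n : nat, (m (box (0%R, 0%R) n%:R) < +oo)%E) -> sigma_finite setT m.
Proof.
move=> fm; exists (fun n => box (0, 0) n%:R); last first.
  by move=> n; split; [exact: measurable_box|exact: fm].
apply/esym/seteqP; split => // w _.
exists (Num.truncn (`|w.1| + `|w.2|)).+1 => //; apply/boxP; rewrite /= !subr0.
have ww : `|w.1| + `|w.2| < (Num.truncn (`|w.1| + `|w.2|)).+1%:R by exact: truncnS_gt.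
by split; apply: ltW; apply: le_lt_trans ww; rewrite ?lerDl ?lerDr.
Qed.

Lemma area_sigma_finite : sigma_finite setT area.
Proof.
by apply: sigma_finite_boxes => n; rewrite [X in (X < _)%E]area_box ?ltry.
Qed.

Let sfarea : {sigma_finite_measure set (plane R) -> \bar R} :=
  sigma_finite_copy _ _ _ _ area_sigma_finite.

(** The relation [|x.2 - x.1| < r] as one subset of the product, to which Tonelli
    applies; its sections are discs. *)
Definition near_pairs (r : R) : set (plane R * plane R) :=
  [set x | nsq (x.2 - x.1) < r ^+ 2].

Definition ball2 (z : R * R) (r : R) : set (plane R) := [set w | nsq (w - z) < r ^+ 2].

Lemma measurable_near_pairs r : measurable (near_pairs r).
Proof.
have -> : near_pairs r = setT `&` (fun x : plane R * plane R => nsq (x.2 - x.1)) @^-1` `]-oo, (r ^+ 2)[.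
  by rewrite setTI; apply/seteqP; split => x; rewrite /near_pairs /= in_itv.
by apply: measurable_nsqB => //; exact: measurable_itv.
Qed.

Lemma measurable_ball2 z r : measurable (ball2 z r).
Proof.
have -> : ball2 z r = xsection (near_pairs r) z.
  by apply/seteqP; split => w; rewrite /xsection /= inE.
exact: measurable_xsection (measurable_near_pairs r).
Qed.

Lemma nsq_triangle (a b c : R * R) : nsq (a - c) <= 2 * nsq (a - b) + 2 * nsq (b - c).
Proof.
rewrite /nsq /=; have := sqr_ge0 ((a.1 - b.1) - (b.1 - c.1)).
have := sqr_ge0 ((a.2 - b.2) - (b.2 - c.2)); lra.
Qed.

(** Halving the rate makes up for the displacement on the disc, because
    [|x - w|^2 <= 2 |x - z|^2 + 2 |z - w|^2]. *)
Lemma gauss_le_average (c r : R) w z : 0 < c -> 0 < r ->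
  ((gauss c w z)%:E <= (expR (c * r ^+ 2) / r ^+ 2)%:E *
    \int[area]_x (gauss (c / 2) w x * \1_(near_pairs r) (z, x))%:E)%E.
Proof.
move=> c0 r0; have r20 : 0 < r ^+ 2 by rewrite exprn_gt0.
have mk : measurable_fun setT (fun x : plane R => (gauss (c / 2) w x * \1_(near_pairs r) (z, x))%:E).
  apply/measurable_EFinP; apply: measurable_funM; first exact: measurable_gauss.
  apply: (@measurableT_comp _ _ _ _ _ _ (\1_(near_pairs r) : plane R * plane R -> R) _ (fun x : plane R => ((z : plane R), x))).
    by apply: measurable_indic; exact: measurable_near_pairs.
  exact: measurable_pair1.
have k0 x : (0 <= (gauss (c / 2) w x * \1_(near_pairs r) (z, x))%:E)%E.
  by rewrite lee_fin mulr_ge0 ?gauss_ge0.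
apply: (@le_trans _ _ ((expR (c * r ^+ 2) / r ^+ 2)%:E *
    \int[area]_(x in box z (r / 2)) cst (expR (- (c * r ^+ 2)) * gauss c w z)%:E x)%E).
  rewrite integral_cst; last exact: measurable_box.
  rewrite [X in (_ <= _ * (_ * X))%E](area_box z (r / 2)) ?divr_ge0 ?(ltW r0) //.
  rewrite -!EFinM lee_fin expRN le_eqVlt; apply/orP; left; apply/eqP.
  by field; rewrite !gt_eqF ?expR_gt0.
apply: lee_wpmul2l; first by rewrite lee_fin divr_ge0 ?expR_ge0 // ltW.
apply: (@le_trans _ _ (\int[area]_(x in box z (r / 2)) (gauss (c / 2) w x * \1_(near_pairs r) (z, x))%:E)%E); last first.
  apply: ge0_subset_integral => //; first exact: measurable_box.
apply: ge0_le_integral => //; first exact: measurable_box.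
- by move=> x _; rewrite lee_fin mulr_ge0 ?expR_ge0 ?gauss_ge0.
- exact: measurable_funTS mk.
move=> x /boxP[x1 x2]; have zx : nsq (x - z) < r ^+ 2.
  move: x1 x2; rewrite /nsq /= !ler_norml => /andP[? ?] /andP[? ?].
  have : (x.1 - z.1) ^+ 2 <= (r / 2) ^+ 2 by nra.
  have : (x.2 - z.2) ^+ 2 <= (r / 2) ^+ 2 by nra.
  by nra.
rewrite lee_fin indicE mem_set // mulr1 -expRD ler_expR.
have := nsq_triangle x z w; nra.
Qed.

Variable mu : {sigma_finite_measure set (plane R) -> \bar R}.

Lemma measurable_mu_ball2 r : measurable_fun setT (fun z : plane R => mu (ball2 z r)).
Proof.
have -> : (fun z : plane R => mu (ball2 z r)) = mu \o xsection (near_pairs r).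
  apply/funext => z /=; congr (mu _).
  by apply/seteqP; split => w; rewrite /xsection /= inE.
exact: measurable_fun_xsection (measurable_near_pairs r).
Qed.

(** Integrate the previous inequality and exchange the integrals: the sections
    of [near_pairs r] in the first variable have measure [mu (ball2 x r)]. *)
Lemma gauss_potential_le (c r : R) w : 0 < c -> 0 < r ->
  (\int[mu]_z (gauss c w z)%:E <= (expR (c * r ^+ 2) / r ^+ 2)%:E *
    \int[area]_x ((gauss (c / 2) w x)%:E * mu (ball2 x r)))%E.
Proof.
move=> c0 r0.
have mk : measurable_fun setT (fun x : plane R * plane R =>
    (gauss (c / 2) w x.2 * \1_(near_pairs r) x)%:E).
  apply/measurable_EFinP; apply: measurable_funM.
    by apply: (measurableT_comp (measurable_gauss (c / 2) w)); exact: measurable_snd.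
  by apply: measurable_indic; exact: measurable_near_pairs.
have k0 x : (0 <= (gauss (c / 2) w x.2 * \1_(near_pairs r) x)%:E)%E.
  by rewrite lee_fin mulr_ge0 ?gauss_ge0.
have C0 : (0 <= (expR (c * r ^+ 2) / r ^+ 2)%:E)%E.
  by rewrite lee_fin divr_ge0 ?expR_ge0 // sqr_ge0.
apply: (@le_trans _ _ (\int[mu]_z ((expR (c * r ^+ 2) / r ^+ 2)%:E *
    \int[area]_x (gauss (c / 2) w x * \1_(near_pairs r) (z, x))%:E))%E).
  apply: ge0_le_integral => //.
  - by move=> z _; rewrite lee_fin gauss_ge0.
  - by apply/measurable_EFinP; exact: measurable_gauss.
  - apply: measurable_funeM; exact: (@measurable_fun_fubini_tonelli_F _ _ _ _ _ sfarea _ mk k0).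
  - by move=> z _; exact: gauss_le_average.
rewrite ge0_integralZl //; last 2 first.
- exact: (@measurable_fun_fubini_tonelli_F _ _ _ _ _ sfarea _ mk k0).
  by move=> z _; apply: integral_ge0 => x _; exact: (k0 (z, x)).
rewrite (@fubini_tonelli _ _ _ _ _ mu sfarea _ mk k0).
apply: lee_wpmul2l => //; rewrite le_eqVlt; apply/orP; left; apply/eqP.
apply: eq_integral => x _.
under eq_integral do rewrite /= EFinM.
rewrite ge0_integralZl //; last 2 first.
- apply/measurable_EFinP.
  apply: (@measurableT_comp _ _ _ _ _ _ (\1_(near_pairs r) : plane R * plane R -> R) _ (fun z : plane R => (z, x))).
    by apply: measurable_indic; exact: measurable_near_pairs.
  exact: measurable_pair2.
- by rewrite lee_fin gauss_ge0.
congr (_ * _)%E.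
transitivity (\int[mu]_z (\1_(ball2 x r) z)%:E)%E; last first.
  by rewrite integral_indic ?setIT //; exact: measurable_ball2.
apply: eq_integral => z _; rewrite !indicE; congr ((nat_of_bool _)%:R%:E).
by apply/idP/idP; rewrite !inE /near_pairs /ball2 /= nsqBC.
Qed.

End potential.

Section potential_decay.
Context {R : realType}.
Local Notation area := (area R).

(** For nonnegative [f] this is convergence to [0] as [|x|] tends to infinity. *)
Definition small_at_infinity (f : R * R -> \bar R) :=
  forall e : R, 0 < e -> exists M : R, forall x, M < nsq x -> (f x <= e%:E)%E.

Variables (mu : {sigma_finite_measure set (plane R) -> \bar R}) (c r : R).
Hypotheses (c0 : 0 < c) (r0 : 0 < r).
Variable N0 : R.
Hypothesis muN0 : forall x, (mu (ball2 x r) <= N0%:E)%E.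

Let N0_ge0 : 0 <= N0.
Proof. by rewrite -lee_fin (le_trans _ (muN0 0)). Qed.

Let C := expR (c * r ^+ 2) / r ^+ 2.

Let C_gt0 : 0 < C.
Proof. by rewrite divr_gt0 ?expR_gt0 // exprn_gt0. Qed.

Let measurable_gaussE b w : measurable_fun setT (fun x : plane R => (gauss b w x)%:E).
Proof. by apply/measurable_EFinP; exact: measurable_gauss. Qed.

Lemma potential_bounded : exists2 N : R, 0 <= N &
  forall w, (\int[mu]_z (gauss c w z)%:E <= N%:E)%E.
Proof.
have c20 : 0 < c / 2 by rewrite divr_gt0.
have [K K0 hK] := integral_gauss _ c20.
exists (C * (K * N0)) => [|w]; first by rewrite mulr_ge0 ?(ltW C_gt0) ?mulr_ge0.
apply: le_trans (gauss_potential_le mu c r w c0 r0) _.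
rewrite [leRHS]EFinM; apply: lee_wpmul2l; first by rewrite lee_fin ltW.
apply: (@le_trans _ _ (\int[area]_x ((gauss (c / 2) w x)%:E * N0%:E))%E).
  apply: ge0_le_integral => //.
  - by move=> x _; rewrite mule_ge0 // lee_fin gauss_ge0.
  - by apply: emeasurable_funM => //; exact: measurable_mu_ball2.
  - by apply: emeasurable_funM => //; exact: measurable_cst.
  - by move=> x _; apply: lee_wpmul2l => //; rewrite lee_fin gauss_ge0.
rewrite ge0_integralZr //; last by move=> x _; rewrite lee_fin gauss_ge0.
by rewrite EFinM; apply: lee_wpmul2r; rewrite ?lee_fin.
Qed.

Hypothesis mu_small : small_at_infinity (fun x => mu (ball2 x r)).

(** Split the average of [x |-> mu (ball2 x r)] according to whether [x] is far
    from the origin, where the measure of the disc is small, or not, where the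
    Gaussian centred at the remote point [w] is small. *)
Lemma potential_vanishes : small_at_infinity (fun w => \int[mu]_z (gauss c w z)%:E)%E.
Proof.
move=> e e0.
have c20 : 0 < c / 2 by rewrite divr_gt0.
have c40 : 0 < c / 4 by rewrite divr_gt0.
have [K2 K20 hK2] := integral_gauss _ c20.
have [K4 K40 hK4] := integral_gauss _ c40.
pose e1 : R := e / (2 * C * (K2 + 1)).
have K21 : 0 < K2 + 1 by rewrite ltr_wpDl.
have e10 : 0 < e1 by rewrite divr_gt0 // mulr_gt0 // mulr_gt0.
have [M hM] := mu_small _ e10.
pose q : R := C * N0 * K4 * expR (c / 4 * M).
have q0 : 0 <= q by rewrite mulr_ge0 ?expR_ge0 // mulr_ge0 // mulr_ge0 // ltW.
exists (8 / c * (2 * q / e)) => w Mw.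
pose b : R := N0 * expR (- (c / 4) * (nsq w / 2 - M)).
have b0 : 0 <= b by rewrite mulr_ge0 ?expR_ge0.
have pt x : ((gauss (c / 2) w x)%:E * mu (ball2 x r) <=
    e1%:E * (gauss (c / 2) w x)%:E + b%:E * (gauss (c / 4) w x)%:E)%E.
  have [Mx|xM] := ltP M (nsq x).
    apply: (@le_trans _ _ (e1%:E * (gauss (c / 2) w x)%:E)%E).
      by rewrite muleC; apply: lee_wpmul2r; rewrite ?lee_fin ?gauss_ge0 //; exact: hM.
    by rewrite leeDl // mule_ge0 // lee_fin ?gauss_ge0.
  apply: (@le_trans _ _ (b%:E * (gauss (c / 4) w x)%:E)%E); last first.
    by rewrite leeDr // mule_ge0 // lee_fin ?gauss_ge0 // ltW.
  apply: (@le_trans _ _ ((gauss (c / 2) w x)%:E * N0%:E)%E).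
    by apply: lee_wpmul2l; rewrite ?lee_fin ?gauss_ge0.
  rewrite -!EFinM lee_fin mulrC /b -mulrA ler_wpM2l // -expRD ler_expR.
  have := nsq_triangle w x 0; rewrite (nsqBC w x) !subr0 => tr.
  have : c / 4 * nsq w <= c / 4 * (2 * nsq (x - w) + 2 * nsq x) by rewrite ler_pM2l.
  have : c / 4 * nsq x <= c / 4 * M by rewrite ler_pM2l.
  lra.
apply: le_trans (gauss_potential_le mu c r w c0 r0) _; rewrite -/C.
apply: (@le_trans _ _ (C%:E * (e1 * K2 + b * K4)%:E)%E); last first.
  rewrite -EFinM lee_fin.
  have h1 : C * (e1 * K2) <= e / 2.
    have -> : C * (e1 * K2) = e / 2 * (K2 / (K2 + 1)).
      by rewrite /e1; field; rewrite !gt_eqF.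
    by rewrite ler_piMr ?divr_ge0 ?(ltW e0) // ler_pdivrMr ?mul1r ?lerDl.
  have h2 : C * (b * K4) <= e / 2.
    have -> : C * (b * K4) = q * expR (- (c / 8 * nsq w)).
      rewrite /b /q (_ : - (c / 4) * (nsq w / 2 - M) = c / 4 * M - c / 8 * nsq w); last by field.
      by rewrite expRD; ring.
    rewrite expRN ler_pdivrMr ?expR_gt0 //.
    have := expR_ge1Dx (c / 8 * nsq w) => ex.
    have : q <= e / 2 * (c / 8 * nsq w).
      have : 2 * q / e < c / 8 * nsq w by rewrite -ltr_pdivrMl ?divr_gt0 // invf_div.
      by rewrite ltr_pdivrMr // => ?; lra.
    have : e / 2 * (1 + c / 8 * nsq w) <= e / 2 * expR (c / 8 * nsq w).
      by rewrite ler_wpM2l // divr_ge0 // ltW.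
    by lra.
  by lra.
apply: lee_wpmul2l; first by rewrite lee_fin ltW.
apply: (@le_trans _ _ (\int[area]_x (e1%:E * (gauss (c / 2) w x)%:E + b%:E * (gauss (c / 4) w x)%:E))%E).
  apply: ge0_le_integral => //.
  - by move=> x _; rewrite mule_ge0 // lee_fin gauss_ge0.
  - by apply: emeasurable_funM => //; exact: measurable_mu_ball2.
  - by apply: emeasurable_funD; exact: measurable_funeM.
rewrite ge0_integralD //; last 4 first.
- by move=> x _; rewrite mule_ge0 // lee_fin ?gauss_ge0 // ltW.
- exact: measurable_funeM.
- by move=> x _; rewrite mule_ge0 // lee_fin gauss_ge0.
- exact: measurable_funeM.
rewrite !ge0_integralZl //; try by [move=> x _; rewrite lee_fin gauss_ge0 | rewrite lee_fin ltW].
by rewrite EFinD !EFinM; apply: leeD; apply: lee_wpmul2l; rewrite ?lee_fin // ltW.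
Qed.

End potential_decay.

(** * From the complex plane to pairs of real numbers *)

Section complex_plane.
Context {R : realType}.

Definition ofC (z : R[i]) : R * R := (complex.Re z, complex.Im z).

Lemma toCK (w : R * R) : ofC (toC w) = w. Proof. by case: w. Qed.

Lemma ofCK (z : R[i]) : toC (ofC z) = z. Proof. by case: z. Qed.

Lemma normc_nsq (z : R[i]) : normc z ^+ 2 = nsq (ofC z).
Proof. by case: z => a b; rewrite /normc sqr_sqrtr // addr_ge0 ?sqr_ge0. Qed.

Lemma normc_ge0 (z : R[i]) : 0 <= normc z.
Proof. by case: z => a b; exact: sqrtr_ge0. Qed.

Lemma normc_le (z : R[i]) : normc z <= `|complex.Re z| + `|complex.Im z|.
Proof.
rewrite -(ler_pXn2r (n := 2)) // ?nnegrE ?addr_ge0 ?normc_ge0 //.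
rewrite normc_nsq /nsq /= -(real_normK (num_real (complex.Re z))).
rewrite -(real_normK (num_real (complex.Im z))).
have := mulr_ge0 (normr_ge0 (complex.Re z)) (normr_ge0 (complex.Im z)); lra.
Qed.

Lemma ge_normc_Re (z : R[i]) : `|complex.Re z| <= normc z.
Proof.
rewrite -(ler_pXn2r (n := 2)) // ?nnegrE ?normc_ge0 //.
by rewrite normc_nsq /nsq /= (real_normK (num_real _)) lerDl sqr_ge0.
Qed.

Lemma ge_normc_Im (z : R[i]) : `|complex.Im z| <= normc z.
Proof.
rewrite -(ler_pXn2r (n := 2)) // ?nnegrE ?normc_ge0 //.
by rewrite normc_nsq /nsq /= (real_normK (num_real _)) lerDr sqr_ge0.
Qed.

Lemma disk_ball2 (z : R[i]) (r : R) : 0 < r -> disk z r = ball2 (ofC z) r.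
Proof.
move=> r0; apply/seteqP; split => w; rewrite /disk /ball2 /=.
  rewrite -(ltr_pXn2r (n := 2)) ?nnegrE ?normc_ge0 ?(ltW r0) // normc_nsq.
  by case: w; case: z.
move=> h; rewrite -(ltr_pXn2r (n := 2)) ?nnegrE ?normc_ge0 ?(ltW r0) // normc_nsq.
by move: h; case: w; case: z.
Qed.

Lemma cvge0_0P (T : Type) (F : set_system T) (FF : Filter F) (f : T -> \bar R) :
  (forall x, (0 <= f x)%E) ->
  f x @[x --> F] --> 0%E <-> forall e : R, 0 < e -> \forall x \near F, (f x <= e%:E)%E.
Proof.
move=> f0; split => [cf e e0|sf].
  have : nbhs (0 : \bar R)%E [set y : \bar R | (y < e%:E)%E].
    by apply: open_nbhs_nbhs; split; [exact: open_ereal_lt_ereal|rewrite /= lte_fin].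
  move=> /cf; apply: (@filterS _ F FF) => x; exact: ltW.
move=> A; rewrite /nbhs /= => -[e /= e0 eA].
have e20 : 0 < e / 2 by rewrite divr_gt0.
apply: (@filterS _ F FF _ _ _ (sf _ e20)) => x.
have := f0 x; rewrite /=; case: (f x) => [t| |] //; rewrite !lee_fin => t0 te.
apply: eA; rewrite /ball /= sub0r normrN ger0_norm //.
by apply: le_lt_trans te _; rewrite ltr_pdivrMr //; lra.
Qed.

Lemma near_cinftyP (P : R[i] -> Prop) :
  (\forall z \near cinfty R, P z) <-> exists M : R, forall x, M < nsq x -> P (toC x).
Proof.
split => [[M _ hM]|[M hM]].
  exists (M ^+ 2) => x Mx; apply: hM => /=.
  rewrite ltNge; apply/negP => xM; move: Mx; rewrite ltNge => /negP; apply.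
  rewrite -[nsq x](congr1 nsq (toCK x)) -normc_nsq.
  by rewrite ler_pXn2r // nnegrE ?(le_trans _ xM) ?normc_ge0.
exists (`|M| + 1) => // z /= Mz; rewrite -(ofCK z); apply: hM; rewrite -normc_nsq.
have : (`|M| + 1) ^+ 2 < normc z ^+ 2 by rewrite ltr_pXn2r // nnegrE ?normc_ge0 // addr_ge0.
have := ler_norm M; have := normr_ge0 M; nra.
Qed.

Lemma cinfty_filter : Filter (cinfty R).
Proof.
apply: filter_from_filter; first by exists 0.
move=> M M' _ _; exists (Num.max M M') => // z /=.
by rewrite gt_max => /andP[].
Qed.

Lemma cvg0_cinfty (f : R[i] -> \bar R) : (forall z, (0 <= f z)%E) ->
  f z @[z --> cinfty R] --> 0%E <-> small_at_infinity (fun x => f (toC x)).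
Proof.
move=> f0; rewrite (cvge0_0P _ _ cinfty_filter _ f0).
by split => h e /h; rewrite near_cinftyP.
Qed.

End complex_plane.

(** * From potentials to vanishing Fock-Carleson measures *)

Section fock.
Context {R : realType}.
Local Notation area := (area R).
Variables (alpha p : R).
Hypotheses (alpha0 : 0 < alpha) (p1 : 1 <= p).

Definition amp (f : R[i] -> R[i]) (w : R * R) : R :=
  normc (f (toC w)) * expR (- (alpha * normc (toC w) ^+ 2 / 2)).

Let p0 : 0 < p. Proof. exact: lt_le_trans ltr01 p1. Qed.

Lemma weightE (w : R * R) :
  expR (- (alpha * normc (toC w) ^+ 2 / 2)) = expR (- (alpha / 2) * nsq w).
Proof. by rewrite normc_nsq toCK; congr expR; field. Qed.

Lemma amp_ge0 f w : 0 <= amp f w.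
Proof. by rewrite mulr_ge0 ?normc_ge0 ?expR_ge0. Qed.

Lemma real_harmonic_continuous (u : R * R -> R) : real_harmonic u -> continuous u.
Proof.
by move=> /real_harmonic_partials [ux [uy [uxx [uxy [h _ _]]]]]; exact: has_C1_continuous h.
Qed.

Lemma continuous_amp f : complex_harmonic f -> continuous (amp f).
Proof.
move=> [/real_harmonic_continuous cu /real_harmonic_continuous cv].
have -> : amp f = (fun w => Num.sqrt (complex.Re (f (toC w)) ^+ 2 + complex.Im (f (toC w)) ^+ 2) *
    expR (- (alpha / 2) * nsq w)).
  by apply/funext => w; rewrite /amp weightE; congr (_ * _); case: (f (toC w)).
move=> w; apply: cvgM.
  apply: (@continuous_comp _ _ _ (fun w => complex.Re (f (toC w)) ^+ 2 + complex.Im (f (toC w)) ^+ 2) Num.sqrt); last exact: sqrt_continuous.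
  by apply: cvgD; apply: cvgM; [exact: cu|exact: cu|exact: cv|exact: cv].
apply: (@continuous_comp _ _ _ (fun w => - (alpha / 2) * nsq w) expR).
  by apply: cvgM; [exact: cvg_cst|exact: continuous_nsq].
exact: continuous_expR.
Qed.

Lemma measurable_amp f : complex_harmonic f ->
  measurable_fun setT (fun w : plane R => ((amp f w) `^ p)%:E).
Proof.
move=> hf; apply/measurable_EFinP.
apply: (@measurableT_comp _ _ _ _ _ _ (fun x : R => x `^ p) _ (amp f)).
  exact: measurable_powR.
by apply: continuous_measurable_plane; exact: continuous_amp.
Qed.

(** Both the real and the imaginary part are dominated by [f].  The real bound
    is used with [A^p] slightly above the integral, so as to have [A > 0]. *)
Lemma complex_growth : exists2 C : R, 0 < C & forall f, complex_harmonic f -> forall z,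
  (((amp f z) `^ p)%:E <=
   C%:E * \int[area]_w ((amp f w) `^ p * gauss (alpha / 8) z w)%:E)%E.
Proof.
have [C C0 growth] := growth_bound _ _ alpha0 p1.
exists ((2 * C) `^ p) => [|f hf z]; first by rewrite powR_gt0 // mulr_gt0.
set I := integral _ _ _.
have I0 : (0 <= I)%E.
  by apply: integral_ge0 => w _; rewrite lee_fin mulr_ge0 ?powR_ge0 ?gauss_ge0.
have Cp : 0 < (2 * C) `^ p by rewrite powR_gt0 // mulr_gt0.
have [->|[i i0 Ii]] : I = +oo%E \/ exists2 i : R, 0 <= i & I = i%:E.
- by case: (I) I0 => [i| |] // i0; [right; exists i|left].
- by rewrite gt0_muley ?lte_fin // leey.
rewrite Ii -EFinM lee_fin.
apply/ler_addgt0Pr => e e0.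
pose e' := e / (2 * C) `^ p; have e'0 : 0 < e' by rewrite divr_gt0.
pose A := (i + e') `^ p^-1.
have ie : 0 < i + e' by rewrite ltr_wpDl.
have A0 : 0 < A by rewrite powR_gt0.
have Ap : A `^ p = i + e' by rewrite /A -powRrM mulVf ?powRr1 ?gt_eqF // ltW.
have mono (u : R * R -> R) : real_harmonic u -> (forall w, `|u w| <= normc (f (toC w))) ->
    damped alpha u z <= C * A.
  move=> hu uf; apply: growth => //.
  apply: (@le_trans _ _ I); last by rewrite Ii Ap lee_fin lerDl ltW.
  have cu := real_harmonic_continuous _ hu.
  have mg : measurable_fun setT (fun w : plane R => (gauss (alpha / 8) z w)%:E).
    by apply/measurable_EFinP; exact: measurable_gauss.
  rewrite /I; clear Ii I0 I; apply: ge0_le_integral; first exact: measurableT.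
  - by move=> w _; rewrite lee_fin mulr_ge0 ?powR_ge0 ?expR_ge0.
  - under eq_fun do rewrite EFinM; apply: emeasurable_funM => //.
    by apply/measurable_EFinP; exact: measurable_energy.
  - under eq_fun do rewrite EFinM; apply: emeasurable_funM => //.
    exact: measurable_amp.
  move=> w _; rewrite lee_fin; apply: ler_wpM2r; first exact: gauss_ge0.
  apply: ge0_ler_powR; rewrite ?nnegrE ?(ltW p0) ?damped_ge0 ?amp_ge0 //.
  by rewrite /damped /amp weightE ler_wpM2r ?expR_ge0.
have hu : damped alpha (fun w => complex.Re (f (toC w))) z <= C * A.
  by apply: mono; [case: hf|move=> w; exact: ge_normc_Re].
have hv : damped alpha (fun w => complex.Im (f (toC w))) z <= C * A.
  by apply: mono; [case: hf|move=> w; exact: ge_normc_Im].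
have fz : amp f z <= 2 * C * A.
  have : amp f z <= damped alpha (fun w => complex.Re (f (toC w))) z +
      damped alpha (fun w => complex.Im (f (toC w))) z.
    by rewrite /amp /damped weightE -mulrDl ler_wpM2r ?expR_ge0 // normc_le.
  by lra.
apply: (@le_trans _ _ ((2 * C * A) `^ p)).
  by apply: ge0_ler_powR; rewrite ?nnegrE ?(ltW p0) ?amp_ge0 // !mulr_ge0 // ltW.
rewrite powRM ?mulr_ge0 ?(ltW C0) ?(ltW A0) // Ap mulrDr /e'.
by rewrite mulrCA divff ?mulr1 // gt_eqF.
Qed.

Variable mu : {sigma_finite_measure set (plane R) -> \bar R}.

(** Tonelli turns the pointwise bound into a comparison of the two weighted
    integrals through the Gaussian potential of the measure. *)
Lemma weighted_integral_le_potential : exists2 C : R, 0 < C & forall f, complex_harmonic f ->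
  (weighted_integral alpha p mu f <=
   C%:E * \int[area]_w ((amp f w `^ p)%:E * \int[mu]_z (gauss (alpha / 8) w z)%:E))%E.
Proof.
have [C C0 growth] := complex_growth; exists C => // f hf.
have mk : measurable_fun setT (fun x : plane R * plane R =>
    (amp f x.2 `^ p * gauss (alpha / 8) x.1 x.2)%:E).
  apply/measurable_EFinP; apply: measurable_funM; last exact: measurable_gauss2.
  apply: (@measurableT_comp _ _ _ _ _ _ (fun w : plane R => amp f w `^ p) _ snd).
    by apply/measurable_EFinP; exact: measurable_amp.
  exact: measurable_snd.
have k0 x : (0 <= (amp f x.2 `^ p * gauss (alpha / 8) x.1 x.2)%:E)%E.
  by rewrite lee_fin mulr_ge0 ?powR_ge0 ?gauss_ge0.
pose sfarea := sigma_finite_copy _ _ _ _ (@area_sigma_finite R).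
have mF := @measurable_fun_fubini_tonelli_F _ _ _ _ _ sfarea _ mk k0.
apply: (@le_trans _ _ (\int[mu]_z (C%:E *
    \int[area]_w (amp f w `^ p * gauss (alpha / 8) z w)%:E))%E).
  apply: ge0_le_integral => //.
  - by move=> z _; rewrite lee_fin powR_ge0.
  - exact: measurable_amp.
  - exact: measurable_funeM.
  - by move=> z _; exact: growth.
rewrite ge0_integralZl //; last 2 first.
- by move=> z _; apply: integral_ge0 => w _; exact: (k0 (z, w)).
- by rewrite lee_fin ltW.
rewrite (@fubini_tonelli _ _ _ _ _ mu sfarea _ mk k0).
apply: lee_wpmul2l; first by rewrite lee_fin ltW.
rewrite le_eqVlt; apply/orP; left; apply/eqP; apply: eq_integral => w _.
under eq_integral => z _ do rewrite /= EFinM gaussC.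
rewrite ge0_integralZl //.
- by apply/measurable_EFinP; exact: measurable_gauss.
- by move=> z _; rewrite lee_fin gauss_ge0.
- by rewrite lee_fin powR_ge0.
Qed.

End fock.

Section vanishing.
Context {R : realType}.
Local Notation area := (area R).
Variables (alpha p : R).
Hypotheses (alpha0 : 0 < alpha) (p1 : 1 <= p).

Let p0 : 0 < p. Proof. exact: lt_le_trans ltr01 p1. Qed.

Lemma weighted_integral_ge0 (m : {measure set (plane R) -> \bar R}) f :
  (0 <= weighted_integral alpha p m f)%E.
Proof. by apply: integral_ge0 => w _; rewrite lee_fin powR_ge0. Qed.

Let k : R := p * alpha / (2 * pi).

Let k0 : 0 < k.
Proof. by rewrite divr_gt0 ?mulr_gt0 ?pi_gt0. Qed.

Lemma weighted_integral_le_of_norm f (M : R) :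
  (fock_norm alpha p f <= M%:E)%E ->
  (weighted_integral alpha p area f <= (`|M| `^ p / k)%:E)%E.
Proof.
rewrite /fock_norm -/k => fM.
have I0 := weighted_integral_ge0 area f; set I := weighted_integral _ _ _ _ in I0 fM *.
have kI0 : (0 <= k%:E * I)%E by rewrite mule_ge0 // lee_fin ltW.
have : (k%:E * I <= (`|M| `^ p)%:E)%E.
  have -> : (k%:E * I = poweR (poweR (k%:E * I) p^-1) p)%E.
    by rewrite -poweRrM mulVf ?gt_eqF // poweRe1.
  rewrite -poweR_EFin; apply: gt0_ler_poweR; rewrite ?(ltW p0) //.
  - by rewrite in_itv /= poweR_ge0 leey.
  - by rewrite in_itv /= lee_fin normr_ge0 leey.
  - by apply: le_trans fM _; rewrite lee_fin ler_norm.
move=> h; have := lee_wpmul2l (_ : 0 <= (k^-1)%:E)%E h.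
rewrite muleA -EFinM mulVf ?gt_eqF // mul1e -EFinM mulrC; apply.
by rewrite lee_fin invr_ge0 ltW.
Qed.

Lemma fock_norm_le_of_weighted f (K : R) : 0 <= K ->
  (weighted_integral alpha p area f <= K%:E)%E ->
  (fock_norm alpha p f <= ((k * K) `^ p^-1)%:E)%E.
Proof.
move=> K0 fK; rewrite /fock_norm -/k -poweR_EFin (EFinM k K).
have I0 := weighted_integral_ge0 area f.
have kI0 : (0 <= k%:E)%E by rewrite lee_fin ltW.
apply: gt0_ler_poweR; rewrite ?invr_ge0 ?(ltW p0) //.
- by rewrite in_itv /= leey andbT mule_ge0.
- by rewrite in_itv /= leey andbT mule_ge0 // lee_fin.
- exact: lee_wpmul2l.
Qed.

Variable mu : {sigma_finite_measure set (plane R) -> \bar R}.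
Let P w := (\int[mu]_z (gauss (alpha / 8) w z)%:E)%E.
Variable N : R.
Hypotheses (N0 : 0 <= N) (PN : forall w, (P w <= N%:E)%E).

Let measurable_P : measurable_fun setT (P : plane R -> \bar R).
Proof.
apply: (@measurable_fun_fubini_tonelli_F _ _ _ _ _ mu
  (fun x : plane R * plane R => (gauss (alpha / 8) x.1 x.2)%:E)).
  by apply/measurable_EFinP; exact: measurable_gauss2.
by move=> x; rewrite lee_fin gauss_ge0.
Qed.

Let P_ge0 w : (0 <= P w)%E.
Proof. by apply: integral_ge0 => z _; rewrite lee_fin gauss_ge0. Qed.

Lemma fock_carleson_of_potential : fock_carleson alpha p mu.
Proof.
have [C C0 hC] := weighted_integral_le_potential _ _ alpha0 p1 mu.
exists (C * N + 1); first by rewrite ltr_wpDl // mulr_ge0 // ltW.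
move=> f [hf _]; apply: le_trans (hC f hf) _.
apply: (@le_trans _ _ ((C * N)%:E * weighted_integral alpha p area f)%E); last first.
  by apply: lee_wpmul2r; rewrite ?weighted_integral_ge0 // lee_fin lerDl.
rewrite (EFinM C N) -muleA; apply: lee_wpmul2l; first by rewrite lee_fin ltW.
have mA := measurable_amp alpha p f hf.
rewrite /weighted_integral -ge0_integralZl //.
apply: ge0_le_integral => //.
- by move=> w _; apply: mule_ge0; [rewrite lee_fin powR_ge0|exact: P_ge0].
- exact: emeasurable_funM.
- exact: measurable_funeM.
- by move=> w _; rewrite muleC; apply: lee_wpmul2r; [rewrite lee_fin powR_ge0|exact: PN].
by move=> w _; rewrite lee_fin powR_ge0.
Qed.

Hypothesis P_small : small_at_infinity P.

(** Outside a large square the potential is small and the norms of the [f n] are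
    bounded; inside, the potential is bounded and the [f n] are eventually
    small. *)
Lemma vanishing_of_potential : vanishing_fock_carleson alpha p mu.
Proof.
split; first exact: fock_carleson_of_potential.
move=> f hf [M fM] f0; apply/cvge0_0P; first by move=> n; exact: weighted_integral_ge0.
move=> e e0.
have [C C0 hC] := weighted_integral_le_potential _ _ alpha0 p1 mu.
pose B : R := `|M| `^ p / k.
have B0 : 0 <= B by rewrite divr_ge0 ?powR_ge0 // ltW.
have fB n : (weighted_integral alpha p area (f n) <= B%:E)%E.
  exact: weighted_integral_le_of_norm.
pose e1 : R := e / (2 * C * (B + 1)).
have B1 : 0 < B + 1 by rewrite ltr_wpDl.
have e10 : 0 < e1 by rewrite divr_gt0 // mulr_gt0 // mulr_gt0.
have [M1 hM1] := P_small _ e10.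
pose rho : R := `|M1| + 1.
have rho0 : 0 <= rho by rewrite addr_ge0.
have out w : ~ box (0, 0) rho w -> M1 < nsq w.
  move=> nb; rewrite ltNge; apply/negP => wM; apply: nb; apply/boxP; rewrite /= !subr0.
  have nn := normr_ge0 M1; have nM := ler_norm M1.
  have bd (t s : R) : t ^+ 2 + s ^+ 2 <= M1 -> `|t| <= rho.
    move=> ts; rewrite -(ler_pXn2r (n := 2)) // ?nnegrE // (real_normK (num_real t)) /rho.
    by have := sqr_ge0 s; nra.
  by split; [exact: bd wM|apply: (bd _ w.1); rewrite addrC].
pose d : R := Num.min 1 (e / (2 * (C * N * (4 * rho ^+ 2) + 1))).
have q0 : 0 <= C * N * (4 * rho ^+ 2).
  by rewrite mulr_ge0 // ?mulr_ge0 ?sqr_ge0 // ltW.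
have d0 : 0 < d by rewrite lt_min ltr01 divr_gt0 // mulr_gt0 // ltr_wpDl.
have d1 : d <= 1 by rewrite ge_min lexx.
have [n0 _ hn] := f0 _ (compact_box (0, 0) rho) _ d0.
exists n0 => // n n0n; have {}hn := hn _ n0n.
have [hfn _] := hf n; have mA := measurable_amp alpha p (f n) hfn.
have A0 w : (0 <= (amp alpha (f n) w `^ p)%:E)%E by rewrite lee_fin powR_ge0.
(* [d <= 1] and [1 <= p], whence [d^p <= d]. *)
have small w : box (0, 0) rho w -> amp alpha (f n) w `^ p <= d.
  move=> bw; have ad : amp alpha (f n) w <= d.
    rewrite -[leRHS]mulr1 /amp; apply: ler_pM; rewrite ?normc_ge0 ?expR_ge0 //.
      exact/ltW/hn.
    rewrite weightE -[leRHS]expR0 ler_expR mulNr oppr_le0.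
    by rewrite mulr_ge0 ?addr_ge0 ?sqr_ge0 // divr_ge0 // ltW.
  have a0 := amp_ge0 alpha (f n) w.
  have [->|an0] := eqVneq (amp alpha (f n) w) 0; first by rewrite powR0 ?gt_eqF // ltW.
  have apos : 0 < amp alpha (f n) w by rewrite lt_neqAle eq_sym an0.
  apply: le_trans (ad); apply: ge1r_powR => //.
  by rewrite apos (le_trans ad).
apply: le_trans (hC _ hfn) _.
apply: (@le_trans _ _ (C%:E * (e1 * B + N * (d * (4 * rho ^+ 2)))%:E)%E); last first.
  rewrite -EFinM lee_fin.
  have h1 : C * (e1 * B) <= e / 2.
    have -> : C * (e1 * B) = e / 2 * (B / (B + 1)) by rewrite /e1; field; rewrite !gt_eqF.
    by rewrite ler_piMr ?divr_ge0 ?(ltW e0) // ler_pdivrMr ?mul1r ?lerDl.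
  have h2 : (C * N * (4 * rho ^+ 2)) * d <= e / 2.
    set q := C * N * (4 * rho ^+ 2) in q0 *.
    have q1 : 0 < q + 1 by rewrite ltr_wpDl.
    apply: (@le_trans _ _ ((q + 1) * d)); first by rewrite ler_wpM2r ?lerDl // ltW.
    rewrite mulrC -ler_pdivlMr // /d ge_min; apply/orP; right.
    by rewrite -/q le_eqVlt; apply/orP; left; apply/eqP; field; rewrite gt_eqF.
  by lra.
apply: lee_wpmul2l; first by rewrite lee_fin ltW.
apply: (@le_trans _ _ (\int[area]_w (e1%:E * (amp alpha (f n) w `^ p)%:E +
    N%:E * (d%:E * (\1_(box (0%R, 0%R) rho) w)%:E)))%E).
  apply: ge0_le_integral => //.
  - by move=> w _; apply: mule_ge0; [exact: A0|exact: P_ge0].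
  - exact: emeasurable_funM.
  - apply: emeasurable_funD; first exact: measurable_funeM.
    do 2 apply: measurable_funeM.
    by apply/measurable_EFinP; apply: measurable_indic; exact: measurable_box.
  move=> w _; have [bw|nb] := pselect (box (0, 0) rho w).
    rewrite indicE mem_set //= mule1.
    apply: (@le_trans _ _ (N%:E * d%:E)%E); last by rewrite leeDr // mule_ge0 // lee_fin ltW.
    rewrite muleC; apply: lee_pmul; [exact: P_ge0|exact: A0|exact: PN|].
    by rewrite lee_fin; exact: small.
  apply: (@le_trans _ _ (e1%:E * (amp alpha (f n) w `^ p)%:E)%E).
    by rewrite muleC; apply: lee_wpmul2r => //; apply: hM1; exact: out.
  by rewrite leeDl // !mule_ge0 // lee_fin // ltW.
rewrite ge0_integralD //; last 4 first.
- by move=> w _; rewrite mule_ge0 // lee_fin ltW.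
- exact: measurable_funeM.
- by move=> w _; rewrite !mule_ge0 // lee_fin // ltW.
- do 2 apply: measurable_funeM.
  by apply/measurable_EFinP; apply: measurable_indic; exact: measurable_box.
have m1 : measurable_fun setT (fun w : plane R => (\1_(box (0%R, 0%R) rho) w : R)%:E).
  by apply/measurable_EFinP; apply: measurable_indic; exact: measurable_box.
rewrite EFinD; apply: leeD.
  rewrite ge0_integralZl //; last by rewrite lee_fin ltW.
  by rewrite (EFinM e1 B); apply: lee_wpmul2l; [rewrite lee_fin ltW|exact: fB].
rewrite ge0_integralZl //; last 2 first.
- exact: measurable_funeM.
- by move=> w _; rewrite mule_ge0 // lee_fin // ltW.
rewrite ge0_integralZl //; last by rewrite lee_fin ltW.
rewrite integral_indic ?setIT //; last exact: measurable_box.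
by rewrite [X in (_ * (_ * X) <= _)%E](area_box (0, 0) rho) // -!EFinM.
Qed.

End vanishing.

(** * The kernels [k_z] and the Berezin transform *)

Section kernels.
Context {R : realType}.
Variables (alpha p : R).

Lemma Re_kfun (x w : R * R) : complex.Re (kfun alpha (toC x) (toC w)) =
  wave (alpha * x.1) (alpha * x.2) (- (alpha / 2 * nsq x)) 0 1 0 w.
Proof.
rewrite /kfun /cexp normc_nsq toCK /wave; case: x w => [a b] [c d] /=.
rewrite [X in _ = _ * X](_ : _ = cos (- (alpha * b) * c + alpha * a * d + 0)); last by ring.
by congr (expR _ * cos _); ring.
Qed.

Lemma Im_kfun (x w : R * R) : complex.Im (kfun alpha (toC x) (toC w)) =
  wave (alpha * x.1) (alpha * x.2) (- (alpha / 2 * nsq x)) 0 0 1 w.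
Proof.
rewrite /kfun /cexp normc_nsq toCK /wave; case: x w => [a b] [c d] /=.
rewrite [X in _ = _ * X](_ : _ = sin (- (alpha * b) * c + alpha * a * d + 0)); last by ring.
by congr (expR _ * sin _); ring.
Qed.

Lemma complex_harmonic_kfun (x : R * R) : complex_harmonic (kfun alpha (toC x)).
Proof.
split.
  rewrite (_ : (fun w => _) = wave (alpha * x.1) (alpha * x.2) (- (alpha / 2 * nsq x)) 0 1 0).
    exact: real_harmonic_wave.
  by apply/funext => w; exact: Re_kfun.
rewrite (_ : (fun w => _) = wave (alpha * x.1) (alpha * x.2) (- (alpha / 2 * nsq x)) 0 0 1).
  exact: real_harmonic_wave.
by apply/funext => w; exact: Im_kfun.
Qed.

Lemma normc_kfun (x w : R * R) : normc (kfun alpha (toC x) (toC w)) =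
  expR (alpha / 2 * nsq w) * gauss (alpha / 2) x w.
Proof.
apply/eqP; rewrite -(@eqrXn2 _ 2) ?normc_ge0 ?mulr_ge0 ?expR_ge0 //; apply/eqP.
rewrite normc_nsq.
have -> (z : R[i]) : nsq (ofC z) = complex.Re z ^+ 2 + complex.Im z ^+ 2 by [].
rewrite Re_kfun Im_kfun /wave /gauss -expRD.
set t := - _ * _ + _ * _ + _.
transitivity (expR (alpha * x.1 * w.1 + alpha * x.2 * w.2 - alpha / 2 * nsq x) ^+ 2 * (cos t ^+ 2 + sin t ^+ 2)); first by ring.
rewrite cos2Dsin2 mulr1; congr (expR _ ^+ 2).
by rewrite /nsq /=; field.
Qed.

Lemma amp_kfun (x w : R * R) : amp alpha (kfun alpha (toC x)) w = gauss (alpha / 2) x w.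
Proof.
rewrite /amp weightE normc_kfun mulrAC -expRD mulNr subrr expR0 mul1r //.
Qed.

Lemma weighted_kfun (m : {measure set (plane R) -> \bar R}) (x : R * R) :
  weighted_integral alpha p m (kfun alpha (toC x)) =
  (\int[m]_w (gauss (p * alpha / 2) x w)%:E)%E.
Proof.
apply: eq_integral => w _; rewrite -[X in (X `^ _)%:E]/(amp _ _ _) amp_kfun.
by rewrite /gauss -expRM; congr (expR _)%:E; field.
Qed.

(** [h_z] is [sqrt 2] times the real part of [k_z]. *)
Lemma berezinE (m : {measure set (plane R) -> \bar R}) (x : R * R) :
  berezin alpha m (toC x) = (\int[m]_w (2 * gauss alpha x w *
    cos (alpha * (x.1 * w.2 - x.2 * w.1)) ^+ 2)%:E)%E.
Proof.
apply: eq_integral => w _; congr (_%:E).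
rewrite !normc_nsq toCK /hfun; set k := kfun _ _ _.
have -> : nsq (ofC (real_complex R (Num.sqrt 2 / 2) * (k + conjc k))) = 2 * complex.Re k ^+ 2.
  case: k => a b; rewrite /nsq /ofC /=.
  transitivity ((Num.sqrt 2) ^+ 2 * a ^+ 2); first by field.
  by rewrite sqr_sqrtr.
rewrite /k Re_kfun /wave mul1r mul0r addr0 /gauss.
rewrite (_ : - (alpha * x.2) * w.1 + alpha * x.1 * w.2 + 0 = alpha * (x.1 * w.2 - x.2 * w.1)); last by ring.
set c := cos _.
rewrite exprMn [LHS](_ : _ = 2 * (expR (alpha * x.1 * w.1 + alpha * x.2 * w.2 - alpha / 2 * nsq x) ^+ 2 * expR (- (alpha * nsq w))) * c ^+ 2); last by ring.
rewrite expr2 -!expRD; congr (2 * expR _ * _).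
by rewrite /nsq /=; field.
Qed.

End kernels.

Section kernel_tests.
Context {R : realType}.
Variables (alpha p r : R).
Hypotheses (alpha0 : 0 < alpha) (p1 : 1 <= p).
Variable mu : {measure set (plane R) -> \bar R}.

Let p0 : 0 < p. Proof. exact: lt_le_trans ltr01 p1. Qed.

(** The functions [k_z] are themselves admissible: they are holomorphic, of
    constant norm, tend to [0] locally uniformly as [z] tends to infinity, and
    weighted they are Gaussians centred at [z]. *)
Lemma small_of_vanishing : vanishing_fock_carleson alpha p mu ->
  small_at_infinity (fun x => mu (ball2 x r)).
Proof.
move=> [_ van]; apply: contrapT => /existsNP [e /not_implyP [e0 ne]].
have {ne} ex (n : nat) : exists x : R * R, n%:R < nsq x /\ ~ (mu (ball2 x r) <= e%:E)%E.
  by move/forallNP : ne => /(_ n%:R) /existsNP [x /not_implyP h]; exists x.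
have [x hx] := choice ex.
pose f n := kfun alpha (toC (x n)).
have c0 : 0 < p * alpha / 2 by rewrite divr_gt0 ?mulr_gt0.
have [K K0 hK] := integral_gauss _ c0.
have norm_le n : (fock_norm alpha p (f n) <= ((p * alpha / (2 * pi) * K) `^ p^-1)%:E)%E.
  by apply: fock_norm_le_of_weighted => //; rewrite weighted_kfun; exact: hK.
have harm n : harmonic_fock alpha p (f n).
  split; first exact: complex_harmonic_kfun.
  by apply: le_lt_trans (norm_le n) _; rewrite ltry.
have bd : fock_bounded alpha p f by eexists; exact: norm_le.
have cvg0 : cvg0_on_compacts f.
  move=> D cD d d0.
  (* On the compact set, [|w - x|^2 >= |x|^2 / 2 - Q]. *)
  have [Q Q0 hQ] : exists2 Q : R, 0 <= Q & forall w, D w -> nsq w <= Q.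
    have cn : {within D, continuous (@nsq R)} by apply: continuous_subspaceT; exact: continuous_nsq.
    have /compact_bounded[M [_ mrt]] := continuous_compact cn cD.
    exists (`|M| + 1) => [|w Dw]; first by rewrite addr_ge0.
    apply: le_trans (ler_norm _) _; apply: (mrt (`|M| + 1)); first by rewrite ltr_pwDr ?ler_norm.
    by exists w.
  pose q := expR (alpha * Q) / (d * (alpha / 4)).
  have q0 : 0 <= q by rewrite divr_ge0 ?expR_ge0 // mulr_ge0 ?divr_ge0 // ltW.
  exists (Num.truncn q).+1 => // n nq w Dw.
  have qn : q < n%:R.
    by apply: lt_le_trans (truncnS_gt _) _; rewrite ler_nat.
  rewrite /f normc_kfun /gauss -expRD.
  have [nx _] := hx n; have wQ := hQ _ Dw.
  have tr := nsq_triangle (x n) w 0; rewrite (nsqBC (x n) w) !subr0 in tr.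
  apply: (@le_lt_trans _ _ (expR (alpha * Q) * expR (- (alpha / 4 * n%:R)))).
    rewrite -expRD ler_expR.
    have : alpha / 4 * nsq (x n) <= alpha / 4 * (2 * nsq (w - x n) + 2 * nsq w).
      by rewrite ler_pM2l // divr_gt0.
    have : alpha * nsq w <= alpha * Q by rewrite ler_pM2l.
    have : alpha / 4 * n%:R <= alpha / 4 * nsq (x n) by rewrite ler_pM2l ?divr_gt0 // ltW.
    by lra.
  rewrite expRN ltr_pdivrMr ?expR_gt0 // .
  apply: (@lt_le_trans _ _ (d * (alpha / 4) * n%:R)).
    by rewrite -ltr_pdivrMl ?mulr_gt0 ?divr_gt0 // mulrC.
  rewrite -mulrA ler_pM2l //; apply: le_trans (expR_ge1Dx _) => /=.
  by rewrite lerDr.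
have := van f harm bd cvg0.
move/cvge0_0P => /(_ (fun n => weighted_integral_ge0 _ _ mu _)).
pose kap : R := expR (- (p * alpha / 2) * r ^+ 2).
have kap0 : 0 < kap by exact: expR_gt0.
move=> /(_ _ (mulr_gt0 kap0 e0)) [n0 _ /(_ n0 (leqnn _))] /=.
rewrite /f weighted_kfun => small; have [_ []] := hx n0.
set z := x n0 in small *.
have mB := measurable_ball2 z r.
have mg : measurable_fun setT (fun w : plane R => (gauss (p * alpha / 2) z w)%:E).
  by apply/measurable_EFinP; exact: measurable_gauss.
have : (kap%:E * mu (ball2 z r) <= (kap * e)%:E)%E.
  apply: le_trans small; rewrite -integral_cst //.
  apply: (@le_trans _ _ (\int[mu]_(w in ball2 z r) (gauss (p * alpha / 2) z w)%:E)%E).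
    apply: ge0_le_integral => //.
    - by move=> w _; rewrite lee_fin ltW.
    - exact: measurable_funTS mg.
    move=> w /ltW wz; rewrite lee_fin ler_expR !mulNr lerN2.
    by rewrite ler_wpM2l // ltW.
  apply: ge0_subset_integral => //.
  by move=> w _; rewrite lee_fin gauss_ge0.
by rewrite EFinM lee_pmul2l // lte_fin.
Qed.

Lemma abs_sin_le (t : R) : `|sin t| <= `|t|.
Proof.
have [c _] := MVT_everywhere _ _ (@is_derive_sin R) 0 t.
rewrite sin0 !subr0 => ->; rewrite normrM ler_piMl //.
by rewrite ler_norml cos_geN1 cos_le1.
Qed.

Lemma measurable_berezin x : measurable_fun setT
  (fun w : plane R => (2 * gauss alpha x w * cos (alpha * (x.1 * w.2 - x.2 * w.1)) ^+ 2)%:E).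
Proof.
apply/measurable_EFinP; apply: measurable_funM.
  by apply: measurable_funM; [exact: measurable_cst|exact: measurable_gauss].
apply: measurable_funX; apply: continuous_measurable_plane => w.
apply: (@continuous_comp _ _ _ (fun w : R * R => alpha * (x.1 * w.2 - x.2 * w.1)) cos); last exact: continuous_cos.
apply: cvgM; first exact: cvg_cst.
by apply: cvgB; apply: cvgM; try exact: cvg_cst; [exact: cvg_snd|exact: cvg_fst].
Qed.

Lemma berezin_ge0 z : (0 <= berezin alpha mu z)%E.
Proof. by apply: integral_ge0 => w _; rewrite lee_fin mulr_ge0 ?expR_ge0 ?sqr_ge0. Qed.

Lemma berezin_small_of_potential :
  small_at_infinity (fun x => \int[mu]_w (gauss alpha x w)%:E)%E ->
  small_at_infinity (fun x => berezin alpha mu (toC x)).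
Proof.
move=> h e e0; have e20 : 0 < e / 2 by rewrite divr_gt0.
have [M hM] := h _ e20; exists M => x Mx; rewrite berezinE.
have mg : measurable_fun setT (fun w : plane R => (gauss alpha x w)%:E).
  by apply/measurable_EFinP; exact: measurable_gauss.
apply: (@le_trans _ _ (\int[mu]_w (2%:E * (gauss alpha x w)%:E))%E).
  apply: ge0_le_integral => //.
  - by move=> w _; rewrite lee_fin mulr_ge0 ?sqr_ge0 // mulr_ge0 ?gauss_ge0.
  - exact: measurable_berezin.
  - exact: measurable_funeM.
  move=> w _; rewrite -EFinM lee_fin ler_piMr ?mulr_ge0 ?gauss_ge0 //.
rewrite ge0_integralZl //; last by move=> w _; rewrite lee_fin gauss_ge0.
have := lee_wpmul2l (_ : 0 <= 2%:E)%E (hM _ Mx).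
rewrite -EFinM (_ : 2 * (e / 2) = e); last by field.
by apply; rewrite lee_fin.
Qed.

End kernel_tests.

Section berezin_lower_bound.
Context {R : realType}.
Variables (alpha r : R).
Hypotheses (alpha0 : 0 < alpha) (r0 : 0 < r).
Variable mu : {measure set (plane R) -> \bar R}.

(** For [s = 0] the sum is [cos t ^+ 2 + sin t ^+ 2 = 1]. *)
Lemma cos2D_shift_ge (t s : R) : `|s| <= 1 / 4 ->
  1 / 2 <= cos t ^+ 2 + cos (t - (pi / 2 + s)) ^+ 2.
Proof.
move=> s4; have -> : cos (t - (pi / 2 + s)) = sin t * cos s - cos t * sin s.
  by rewrite cosB cosD sinD cos_pihalf sin_pihalf; ring.
have ss := le_trans (abs_sin_le s) s4.
have := cos2Dsin2 t; have := cos2Dsin2 s.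
set ct := cos t; set st := sin t; set cs := cos s; set sn := sin s in ss *.
move=> h1 h2; rewrite ler_norml in ss; case/andP: ss => s1 s2.
have b1 : `|sn * cs * (st * ct)| <= 1 / 8.
  have c1 : `|cs| <= 1 by rewrite ler_norml cos_geN1 cos_le1.
  have sc : `|st * ct| <= 1 / 2.
    have := sqr_ge0 (st - ct); have := sqr_ge0 (st + ct).
    by rewrite ler_norml => ? ?; apply/andP; split; lra.
  have sn4 : `|sn| <= 1 / 4 by rewrite ler_norml s1 s2.
  rewrite normrM (_ : 1 / 8 = 1 / 4 * 1 * (1 / 2)); last by field.
  by apply: ler_pM => //; rewrite normrM; apply: ler_pM.
rewrite ler_norml in b1; case/andP: b1 => b1 b1'.
have sn2 : sn ^+ 2 <= 1 / 16 by nra.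
have -> : ct ^+ 2 + (st * cs - ct * sn) ^+ 2 =
  ct ^+ 2 + st ^+ 2 * cs ^+ 2 + ct ^+ 2 * sn ^+ 2 - 2 * (sn * cs * (st * ct)) by ring.
have : st ^+ 2 * cs ^+ 2 >= st ^+ 2 * (15 / 16) by rewrite ler_wpM2l ?sqr_ge0 //; lra.
have := sqr_ge0 ct; have := mulr_ge0 (sqr_ge0 ct) (sqr_ge0 sn); lra.
Qed.

(** The weight [|h_z|^2] vanishes along lines, but moving [z] orthogonally by
    [pi / (2 alpha |z|)] shifts the phase by almost a quarter of a turn, so that
    the two weights together are bounded below on the whole disc. *)
Lemma small_of_berezin : small_at_infinity (fun x => berezin alpha mu (toC x)) ->
  small_at_infinity (fun x => mu (ball2 x r)).
Proof.
move=> h e e0.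
pose kap : R := expR (- (alpha * (2 * r ^+ 2 + 2))).
have kap0 : 0 < kap by exact: expR_gt0.
have ek0 : 0 < kap * e / 2 by rewrite divr_gt0 ?mulr_gt0.
have [M hM] := h _ ek0.
(* The summands of [Q] ensure in turn that the transform is small at [x] and at
   [y], that the phase error [s] is at most [1/4], that [|x - y| <= 1], and
   that [x] is not [0]. *)
pose Q : R := `|M| + 4 * pi ^+ 2 * r ^+ 2 + pi ^+ 2 / (4 * alpha ^+ 2) + 1.
exists Q => x Qx.
have pos1 : 0 <= 4 * pi ^+ 2 * r ^+ 2 :> R by rewrite mulr_ge0 ?sqr_ge0 // mulr_ge0 ?sqr_ge0.
have pos2 : 0 <= pi ^+ 2 / (4 * alpha ^+ 2) by rewrite divr_ge0 ?sqr_ge0 // mulr_ge0 ?sqr_ge0.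
have Mx : M < nsq x by have := ler_norm M; rewrite /Q in Qx; lra.
have x0 : 0 < nsq x by have := normr_ge0 M; rewrite /Q in Qx; lra.
have xr : 4 * pi ^+ 2 * r ^+ 2 <= nsq x by have := normr_ge0 M; rewrite /Q in Qx; lra.
have xa : pi ^+ 2 / (4 * alpha ^+ 2) <= nsq x by have := normr_ge0 M; rewrite /Q in Qx; lra.
(* [y - x] is orthogonal to [x], of length [pi / (2 alpha |x|)]. *)
pose t : R := pi / (2 * alpha * nsq x).
pose y : R * R := (x.1 - t * x.2, x.2 + t * x.1).
have yx : nsq y = nsq x + t ^+ 2 * nsq x by rewrite /nsq /=; ring.
have My : M < nsq y by rewrite yx (lt_le_trans Mx) // lerDl mulr_ge0 ?sqr_ge0 // ltW.
have dxy : nsq (x - y) <= 1.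
  have -> : nsq (x - y) = t ^+ 2 * nsq x by rewrite /nsq /=; ring.
  have -> : t ^+ 2 * nsq x = pi ^+ 2 / (4 * alpha ^+ 2) / nsq x.
    by rewrite /t; field; rewrite !gt_eqF.
  by rewrite ler_pdivrMr // mul1r.
pose I z (w : R * R) := 2 * gauss alpha z w * cos (alpha * (z.1 * w.2 - z.2 * w.1)) ^+ 2.
have I0 z w : 0 <= I z w by rewrite mulr_ge0 ?sqr_ge0 // mulr_ge0 ?gauss_ge0.
have lower w : ball2 x r w -> kap <= I x w + I y w.
  move=> xw; have {}xw : nsq (w - x) <= r ^+ 2 by exact: ltW.
  have gx : kap <= gauss alpha x w.
    rewrite ler_expR mulNr lerN2 ler_wpM2l ?(ltW alpha0) //.
    by have := sqr_ge0 r; lra.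
  have gy : kap <= gauss alpha y w.
    rewrite ler_expR mulNr lerN2 ler_wpM2l ?(ltW alpha0) //.
    by have := nsq_triangle w x y; lra.
  pose s := alpha * t * (x.1 * (w.1 - x.1) + x.2 * (w.2 - x.2)).
  have s4 : `|s| <= 1 / 4.
    rewrite -(ler_pXn2r (n := 2)) // ?nnegrE // (real_normK (num_real s)).
    have cs : (x.1 * (w.1 - x.1) + x.2 * (w.2 - x.2)) ^+ 2 <= nsq x * r ^+ 2.
      apply: (@le_trans _ _ (nsq x * nsq (w - x))); last by rewrite ler_pM2l.
      rewrite /nsq /=; have := sqr_ge0 (x.1 * (w.2 - x.2) - x.2 * (w.1 - x.1)); lra.
    have -> : s ^+ 2 = (alpha * t) ^+ 2 * (x.1 * (w.1 - x.1) + x.2 * (w.2 - x.2)) ^+ 2.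
      by rewrite -exprMn.
    apply: (@le_trans _ _ ((alpha * t) ^+ 2 * (nsq x * r ^+ 2))).
      by rewrite ler_wpM2l ?sqr_ge0.
    have -> : (alpha * t) ^+ 2 * (nsq x * r ^+ 2) = pi ^+ 2 * r ^+ 2 / (4 * nsq x).
      by rewrite /t; field; rewrite !gt_eqF.
    rewrite ler_pdivrMr ?mulr_gt0 //; lra.
  have := cos2D_shift_ge (alpha * (x.1 * w.2 - x.2 * w.1)) s s4.
  have -> : alpha * (x.1 * w.2 - x.2 * w.1) - (pi / 2 + s) = alpha * (y.1 * w.2 - y.2 * w.1).
    have -> : pi / 2 = alpha * t * nsq x by rewrite /t; field; rewrite !gt_eqF.
    by rewrite /s /nsq /=; ring.
  rewrite /I; set c1 := cos _ ^+ 2; set c2 := cos _ ^+ 2 => cc.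
  have c10 : 0 <= c1 by exact: sqr_ge0.
  have c20 : 0 <= c2 by exact: sqr_ge0.
  have : kap * c1 <= gauss alpha x w * c1 by rewrite ler_wpM2r.
  have : kap * c2 <= gauss alpha y w * c2 by rewrite ler_wpM2r.
  have : kap * (1 / 2) <= kap * (c1 + c2) by rewrite ler_pM2l.
  by lra.
have mB := measurable_ball2 x r.
have mI z : measurable_fun setT (fun w : plane R => (I z w)%:E) by exact: measurable_berezin.
have : (kap%:E * mu (ball2 x r) <= (kap * e)%:E)%E.
  rewrite -integral_cst //.
  apply: (@le_trans _ _ (\int[mu]_(w in ball2 x r) ((I x w)%:E + (I y w)%:E))%E).
    apply: ge0_le_integral => //.
    - by move=> w _; rewrite lee_fin ltW.
    - by apply: measurable_funTS; apply: emeasurable_funD; exact: mI.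
  rewrite ge0_integralD //; last 4 first.
  - by move=> w _; rewrite lee_fin.
  - exact: measurable_funTS (mI x).
  - by move=> w _; rewrite lee_fin.
  - exact: measurable_funTS (mI y).
  rewrite (_ : kap * e = kap * e / 2 + kap * e / 2); last by field.
  rewrite EFinD; apply: leeD.
    apply: le_trans (hM _ Mx); rewrite berezinE; apply: ge0_subset_integral => //.
    by move=> w _; rewrite lee_fin.
  apply: le_trans (hM _ My); rewrite berezinE; apply: ge0_subset_integral => //.
  by move=> w _; rewrite lee_fin.
by rewrite EFinM lee_pmul2l // lte_fin.
Qed.

(** Far away by smallness, elsewhere since the discs lie in one compact set. *)
Lemma mu_ball2_bounded : finite_on_compacts mu ->
  small_at_infinity (fun x => mu (ball2 x r)) ->
  exists N : R, forall x, (mu (ball2 x r) <= N%:E)%E.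
Proof.
move=> fin small; have [M hM] := small _ ltr01.
pose rho : R := `|M| + 1 + r.
have fb : (mu (box (0%R, 0%R) rho) < +oo)%E by apply: fin; exact: compact_box.
have fn : mu (box (0%R, 0%R) rho) \is a fin_num by rewrite ge0_fin_numE.
exists (Num.max 1 (fine (mu (box (0, 0) rho)))) => x.
have [Mx|xM] := ltP M (nsq x).
  by apply: le_trans (hM _ Mx) _; rewrite lee_fin le_max lexx.
apply: (@le_trans _ _ (mu (box (0%R, 0%R) rho))); last first.
  by rewrite -{1}(fineK fn) lee_fin le_max lexx orbT.
apply: le_measure; rewrite ?inE; [exact: measurable_ball2|exact: measurable_box|].
have nn := normr_ge0 M; have nM := ler_norm M.
move=> w xw; rewrite /ball2 /nsq /= in xw.
have bd (a b s q : R) : a ^+ 2 + b ^+ 2 <= M -> (s - a) ^+ 2 + q ^+ 2 < r ^+ 2 -> `|s| <= rho.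
  move=> ab sq.
  have ha : `|a| <= `|M| + 1.
    rewrite -(ler_pXn2r (n := 2)) // ?nnegrE ?addr_ge0 // (real_normK (num_real a)).
    by have := sqr_ge0 b; nra.
  have hs : `|s - a| <= r.
    rewrite -(ler_pXn2r (n := 2)) // ?nnegrE ?(ltW r0) // (real_normK (num_real _)).
    by have := sqr_ge0 q; lra.
  by rewrite -(subrK a s) (le_trans (ler_normD _ _)) // /rho addrC lerD.
apply/boxP; rewrite /= !subr0; split; first exact: bd xM xw.
by apply: (bd x.2 x.1 _ (w.1 - x.1)); rewrite addrC.
Qed.

End berezin_lower_bound.

(** * The equivalence *)

Theorem theorem2p2 (R : realType) (alpha p r : R)
    (mu : {measure set (plane R) -> \bar R}) :
  0 < alpha -> 1 <= p -> 0 < r -> finite_on_compacts mu ->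
  [<-> vanishing_fock_carleson alpha p mu;
       mu (disk z r) @[z --> cinfty R] --> 0%E;
       berezin alpha mu z @[z --> cinfty R] --> 0%E].
Proof.
move=> alpha0 p1 r0 fin.
have sf : sigma_finite setT mu.
  by apply: sigma_finite_boxes => n; apply: fin; exact: compact_box.
pose nu : {sigma_finite_measure set (plane R) -> \bar R} := sigma_finite_copy _ _ _ _ sf.
have diskP : (mu (disk z r) @[z --> cinfty R] --> 0%E) <->
    small_at_infinity (fun x => mu (ball2 x r)).
  rewrite cvg0_cinfty //; split=> h e /h [M hM]; exists M => x /hM;
    by rewrite disk_ball2 // toCK.
have berP := cvg0_cinfty _ (berezin_ge0 alpha mu).
have potential c : 0 < c -> small_at_infinity (fun x => mu (ball2 x r)) ->
    small_at_infinity (fun w => \int[mu]_z (gauss c w z)%:E)%E.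
  move=> c0 small; have [N hN] := mu_ball2_bounded _ r0 _ fin small.
  exact: (potential_vanishes nu _ _ c0 r0 N hN small).
tfae.
- by move=> van; apply/diskP; exact: (small_of_vanishing _ _ _ alpha0 p1 _ van).
- by move=> /diskP small; apply/berP/berezin_small_of_potential => //; exact: potential.
- move=> /berP /(small_of_berezin _ r alpha0) small.
  have a8 : 0 < alpha / 8 by rewrite divr_gt0.
  have [N hN] := mu_ball2_bounded _ r0 _ fin small.
  have [N' N'0 hN'] := potential_bounded nu _ _ a8 r0 N hN.
  exact: (vanishing_of_potential _ _ alpha0 p1 nu N' N'0 hN' (potential _ a8 small)).
Qed.
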